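(* Let $(X,\|\cdot\|)$ be a non-separable real Asplund space. Then there exist a family $\mathcal V$ of subspaces of $X$ and a family $\{Y_V : V\in\mathcal V\}$ of subspaces of $X^*$ such that the following hold. (i) For every infinite cardinal $\aleph<\operatorname{dens} X$, $$\bigcup\{V : V\in\mathcal V,\ \operatorname{dens} V=\aleph\}=X \quad\text{and}\quad \bigcup\{Y_V : V\in\mathcal V,\ \operatorname{dens} V=\aleph\}=X^*.$$ (ii) If $V_1,V_2\in\mathcal V$, then there is $V\in\mathcal V$ such that $V\supset V_1\cup V_2$ and $\operatorname{dens} V=\max\{\operatorname{dens} V_1,\operatorname{dens} V_2\}$. (iii) For every $V\in\mathcal V$ the assignment $Y_V\ni x^*\longmapsto x^*\!\upharpoonright_V=:R_V(x^* )\in V^*$ is a surjective isometry, and hence the mapping $X^*\ni x^*\longmapsto R_V^{-1}(x^*\!\upharpoonright_V)=:P_V(x^* )$ is a norm-$1$ linear projection on $X^*$, with range $Y_V$, and $\operatorname{dens} P_V(X^* )=\operatorname{dens} V$. (iv) $\overline{V}^{\,w^*}=P_V^*(X^{**})$ for every $V\in\mathcal V$. (v) $\mathcal V$ is complete in the following sense: if $\gamma$ is a limit ordinal and $\{V_\alpha : 1\le\alpha<\gamma\}$ is an increasing long sequence of elements of $\mathcal V$ (that is, $V_\alpha\subset V_\beta$ whenever $1\le\alpha<\beta<\gamma$), then $V:=\overline{\bigcup_{1\le\alpha<\gamma}V_\alpha}$ belongs to $\mathcal V$ and $Y_V=\overline{\bigcup_{1\le\alpha<\gamma}Y_{V_\alpha}}$.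 (vi) If $V,U\in\mathcal V$ and $V\subset U$, then $Y_V\subset Y_U$, $P_V\circ P_U=P_V=P_U\circ P_V$, and $(P_U-P_V)(X^* )$ is linearly isometric to $(U/V)^*$.
   Context: A Banach space $X$ is Asplund if (equivalently) $X^*$ is weak$^*$ dentable; equivalently, every separable subspace of $X$ has separable dual. Subspaces are closed linear subspaces. $\operatorname{dens} E$ denotes the density character of $E$, i.e. the least cardinality of a norm-dense subset of $E$. For $x^*\in X^*$ and a subspace $V\subset X$, $x^*\!\upharpoonright_V\in V^*$ is the restriction of $x^*$ to $V$. $X$ is regarded as canonically embedded in $X^{**}$; $\overline{V}^{\,w^*}$ is the closure of $V$ in the weak$^*$ topology of $X^{**}$, and $P_V^*:X^{**}\to X^{**}$ is the adjoint of $P_V:X^*\to X^*$. Overlines without superscript denote norm closures. *)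

(* Defs.v *)
From HB Require Import structures.
From mathcomp Require Import all_boot all_order all_algebra.
From mathcomp Require Import generic_quotient ring_quotient.
From mathcomp Require wochoice.
From mathcomp Require Import all_classical all_reals all_analysis.
Set Implicit Arguments.
Unset Strict Implicit.
Unset Printing Implicit Defensive.
Import Order.TTheory GRing.Theory Num.Theory.
Import numFieldNormedType.Exports.
Local Open Scope classical_set_scope.
Local Open Scope ring_scope.

Section OperatorNorm.
Context {R : realType} {E F : normedModType R}.
Implicit Types f : E -> F.

(* The supremum is a junk value when f is unbounded. *)
Definition op_norm f : R := sup [set `|f x| | x in [set x | `|x| <= 1]].

Definition bounded_linear : {pred E -> F} :=
  fun f => `[< linear f /\ continuous f >].

Lemma bounded_linearP f :
  reflect (linear f /\ exists M, forall x, `|f x| <= M * `|x|)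
    (f \in bounded_linear).
Proof.
apply: (iffP (asboolP _)) => -[lf].
  pose g : {linear E -> F} := HB.pack f (GRing.isLinear.Build _ _ _ _ _ lf).
  move=> cf; split => //.
  have /linear_boundedP : bounded_near g (nbhs (0 : E)).
    exact: (@continuous_linear_bounded _ _ _ 0 g (cf 0)).
  move=> /pinfty_ex_gt0[M _ Mf]; exists M => x; exact: Mf.
move=> [M Mf]; split => //.
pose g : {linear E -> F} := HB.pack f (GRing.isLinear.Build _ _ _ _ _ lf).
apply: (@bounded_linear_continuous _ _ _ g); apply/linear_boundedP.
exists M; split; first exact: num_real.
by move=> N MN x; rewrite (le_trans (Mf x))// ler_wpM2r// ltW.
Qed.

Lemma bounded_linear_submod : submod_closed bounded_linear.
Proof.
split=> [|a f g].
  apply/bounded_linearP; split; last by exists 0 => x; rewrite normr0 mul0r.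
  by move=> b x y; rewrite /GRing.zero/= scaler0 addr0.
move=> /bounded_linearP[lf [M Mf]] /bounded_linearP[lg [N Ng]].
apply/bounded_linearP; split.
  move=> b x y; rewrite -[LHS]/(a *: f (b *: x + y) + g (b *: x + y)).
  rewrite -[RHS]/(b *: (a *: f x + g x) + (a *: f y + g y)).
  by rewrite lf lg !scalerDr !scalerA (mulrC a b) addrACA.
exists (`|a| * M + N) => x; rewrite mulrDl -mulrA.
rewrite -[X in `|X|]/(a *: f x + g x).
rewrite (le_trans (ler_normD _ _))// lerD// normrZ ler_wpM2l//.
Qed.

HB.instance Definition _ :=
  GRing.isSubmodClosed.Build R (E -> F) bounded_linear bounded_linear_submod.

End OperatorNorm.

Section BoundedOperators.
Context {R : realType} {E F : normedModType R}.

Record bop := Bop {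
  bop_fun :> E -> F;
  bop_bounded_linear : bop_fun \in bounded_linear }.

HB.instance Definition _ := [isSub for bop_fun].
HB.instance Definition _ := [Choice of bop by <:].
HB.instance Definition _ := [SubChoice_isSubLmodule of bop by <:].

Lemma bop_linear (f : bop) : linear f.
Proof. by have /bounded_linearP[] := bop_bounded_linear f. Qed.

HB.instance Definition _ (f : bop) :=
  GRing.isLinear.Build R E F *:%R f (bop_linear f).

Lemma bop_has_sup (f : bop) : has_sup [set `|f x| | x in [set x | `|x| <= 1]].
Proof.
split; first by exists `|f 0|, 0 => //=; rewrite normr0.
have /bounded_linearP[_ [M Mf]] := bop_bounded_linear f.
exists (Num.max M 0) => _ [x /= x1 <-]; rewrite (le_trans (Mf x))//.
apply: (@le_trans _ _ (Num.max M 0 * `|x|)).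
  by rewrite ler_wpM2r// le_max lexx.
by rewrite ler_piMr// le_max lexx orbT.
Qed.

Lemma ler_op_norm1 (f : bop) x : `|x| <= 1 -> `|f x| <= op_norm f.
Proof.
by move=> x1; apply: (sup_upper_bound (bop_has_sup f)); exists x.
Qed.

Lemma op_norm_ge0 (f : bop) : 0 <= op_norm f.
Proof. by rewrite (le_trans _ (@ler_op_norm1 f 0 _)) ?normr0. Qed.

Lemma op_norm_le (f : bop) M :
  (forall x, `|x| <= 1 -> `|f x| <= M) -> op_norm f <= M.
Proof.
move=> fM; apply: ge_sup; first exact: (bop_has_sup f).1.
by move=> _ [x /= x1 <-]; exact: fM.
Qed.

Lemma ler_op_norm (f : bop) x : `|f x| <= op_norm f * `|x|.
Proof.
have [->|x0] := eqVneq x 0; first by rewrite linear0 !normr0 mulr0.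
have nx : 0 < `|x| by rewrite normr_gt0.
rewrite -ler_pdivrMr// mulrC -[X in X * _]ger0_norm ?invr_ge0// -normrZ.
rewrite -linearZ; apply: ler_op_norm1.
by rewrite normrZ ger0_norm ?invr_ge0// mulVf// gt_eqF.
Qed.

Lemma op_normD (f g : bop) : op_norm (f + g : bop) <= op_norm f + op_norm g.
Proof.
apply: op_norm_le => x x1; rewrite (le_trans (ler_normD _ _))//.
by rewrite lerD// ler_op_norm1.
Qed.

Lemma op_normZ (a : R) (f : bop) : op_norm (a *: f : bop) = `|a| * op_norm f.
Proof.
have le b (h : bop) : op_norm (b *: h : bop) <= `|b| * op_norm h.
  by apply: op_norm_le => x x1; rewrite normrZ ler_wpM2l// ler_op_norm1.
apply/eqP; rewrite eq_le le/=.
have [->|a0] := eqVneq a 0; first by rewrite normr0 mul0r; exact: (op_norm_ge0 (0 *: f)).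
rewrite -[f in leLHS](scalerK a0) -ler_pdivlMl ?normr_gt0//.
by rewrite -normfV; exact: le.
Qed.

Lemma op_norm0_eq0 (f : bop) : op_norm f = 0 -> f = 0.
Proof.
move=> f0; apply/val_inj/funext => x; apply/eqP.
by rewrite -normr_le0 (le_trans (ler_op_norm f x))// f0 mul0r.
Qed.

HB.instance Definition _ :=
  Lmodule_isNormed.Build R bop op_normD op_normZ op_norm0_eq0.

End BoundedOperators.
Arguments bop {R} E F.

Notation dual E := (bop E _^o).

Section Adjoint.
Context {R : realType} {E F : normedModType R}.

Fact adjoint_bounded (T : bop E F) (f : dual F) :
  (fun x => f (T x)) \in bounded_linear.
Proof.
apply/bounded_linearP; split; first by move=> a x y; rewrite !linearP.
exists (op_norm f * op_norm T) => x.
apply: (le_trans (ler_op_norm f (T x))); rewrite -mulrA.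
by rewrite ler_wpM2l ?op_norm_ge0// ler_op_norm.
Qed.

Definition adjoint_fun (T : bop E F) (f : dual F) : dual E :=
  Bop (adjoint_bounded T f).

Fact adjoint_fun_bounded (T : bop E F) : adjoint_fun T \in bounded_linear.
Proof.
apply/bounded_linearP; split; first by move=> a f g; exact/val_inj/funext.
exists (op_norm T) => f; apply: op_norm_le => x x1.
apply: (le_trans (ler_op_norm f (T x))); rewrite mulrC.
by rewrite ler_wpM2r ?op_norm_ge0// ler_op_norm1.
Qed.

Definition adjoint (T : bop E F) : bop (dual F) (dual E) :=
  Bop (adjoint_fun_bounded T).

End Adjoint.

Section Bidual.
Context {R : realType} (E : normedModType R).

Fact bidual_embed_bounded (x : E) :
  (fun f : dual E => f x) \in @bounded_linear R (dual E) R^o.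
Proof.
apply/bounded_linearP; split; first by [].
by exists `|x| => f; rewrite mulrC; exact: (ler_op_norm f x).
Qed.

Definition bidual_embed (x : E) : dual (dual E) :=
  Bop (bidual_embed_bounded x).

(* Carrier [dual E], with the topology of pointwise convergence on E. *)
Definition weak_star : Type :=
  initial_topology (fun f : dual E => (f : {ptws E -> R^o})).

HB.instance Definition _ := Topological.on weak_star.

End Bidual.

Section ClosedSubspace.
Context {R : realType} (E : normedModType R).

Record csub := CSub {
  csub_set :> set E;
  csub_closed : closed csub_set;
  csub0 : csub_set 0;
  csubP : forall a u v, csub_set u -> csub_set v -> csub_set (a *: u + v) }.

Definition csub_pred (V : csub) : {pred E} := fun x => `[< csub_set V x >].

Fact csub_submod (V : csub) : submod_closed (csub_pred V).
Proof.
split; first exact/asboolP/csub0.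
by move=> a u v /asboolP Vu /asboolP Vv; exact/asboolP/csubP.
Qed.

HB.instance Definition _ (V : csub) :=
  GRing.isSubmodClosed.Build R E (csub_pred V) (csub_submod V).

End ClosedSubspace.

Section SubspaceAsSpace.
Context {R : realType} {E : normedModType R} (V : csub E).

Record csub_space := CSubSpace {
  csub_val : E;
  csub_valP : csub_val \in csub_pred V }.

HB.instance Definition _ := [isSub for csub_val].
HB.instance Definition _ := [Choice of csub_space by <:].
HB.instance Definition _ := [SubChoice_isSubLmodule of csub_space by <:].

Let nrm (x : csub_space) := `|csub_val x|.

Fact csub_normD x y : nrm (x + y) <= nrm x + nrm y.
Proof. exact: ler_normD. Qed.

Fact csub_normZ a x : nrm (a *: x) = `|a| * nrm x.
Proof. exact: normrZ. Qed.

Fact csub_norm0_eq0 x : nrm x = 0 -> x = 0.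
Proof. by move=> /normr0_eq0 x0; exact: val_inj. Qed.

HB.instance Definition _ :=
  Lmodule_isNormed.Build R csub_space csub_normD csub_normZ csub_norm0_eq0.

Fact csub_val_bounded : csub_val \in bounded_linear.
Proof.
by apply/bounded_linearP; split=> [//|]; exists 1 => x; rewrite mul1r.
Qed.

Definition csub_incl : bop csub_space E := Bop csub_val_bounded.

Definition restr : bop (dual E) (dual csub_space) := adjoint csub_incl.

End SubspaceAsSpace.

Section Quotient.
Local Open Scope quotient_scope.
Context {R : realType} {E : normedModType R} (V : csub E).

Definition quot_space := Quotient.quot (csub_pred V).
HB.instance Definition _ := GRing.Zmodule.on quot_space.
HB.instance Definition _ := Choice.on quot_space.

Let Q := Quotient.quot (csub_pred V).

Lemma quot_piP (x y : E) : (\pi_Q x = \pi_Q y) <-> csub_set V (x - y).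
Proof.
rewrite (rwP eqP) -Quotient.idealrBE; split; by move/asboolP.
Qed.

Let scale (a : R) (x : quot_space) : quot_space := \pi_Q (a *: repr (x : Q)).

Let piZ a x : \pi_Q (a *: x) = scale a (\pi_Q x) :> Q.
Proof.
apply/quot_piP; rewrite -scalerBr -[a *: _]addr0; apply: csubP (csub0 _).
by apply/quot_piP; rewrite reprK.
Qed.

Let piD x y : \pi_Q (x + y) = \pi_Q x + \pi_Q y :> Q.
Proof. by rewrite piE. Qed.

Let quot_piK (q : quot_space) : \pi_Q (repr (q : Q)) = q :> quot_space.
Proof. exact: reprK. Qed.

Fact quot_scalerA a b v : scale a (scale b v) = scale (a * b) v.
Proof. by rewrite -[v]quot_piK -!piZ scalerA. Qed.

Fact quot_scale1r : left_id 1 scale.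
Proof. by move=> v; rewrite -[v in LHS]quot_piK -piZ scale1r quot_piK. Qed.

Fact quot_scalerDr : right_distributive scale +%R.
Proof.
by move=> a u v; rewrite -[u]quot_piK -[v]quot_piK -piD -!piZ scalerDr piD.
Qed.

Fact quot_scalerDl v : {morph scale^~ v : a b / a + b}.
Proof. by move=> a b; rewrite -[v]quot_piK -!piZ scalerDl piD. Qed.

HB.instance Definition _ := GRing.Zmodule_isLmodule.Build R quot_space
  quot_scalerA quot_scale1r quot_scalerDr quot_scalerDl.

Definition quot_pi (x : E) : quot_space := \pi_Q x.

(* The quotient norm, i.e. the distance of a representative to V. *)
Definition quot_norm (q : quot_space) : R :=
  inf [set `|x| | x in [set x | quot_pi x = q]].

Let has_inf_quot q : has_inf [set `|x| | x in [set x | quot_pi x = q]].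
Proof.
split; first by exists `|repr (q : Q)|, (repr (q : Q)) => //; exact: reprK.
by exists 0 => _ [x _ <-].
Qed.

Let quot_norm_le x : quot_norm (quot_pi x) <= `|x|.
Proof. by apply: ge_inf; [exact: (has_inf_quot _).2|exists x]. Qed.

Let quot_norm_approx q e : 0 < e -> exists2 x, quot_pi x = q &
  `|x| < quot_norm q + e.
Proof. by move=> e0; have [_ [x <- <-]] := inf_adherent e0 (has_inf_quot q); exists x. Qed.

Fact quot_normD p q : quot_norm (p + q) <= quot_norm p + quot_norm q.
Proof.
apply/ler_addgt0Pr => e e0; have e2 : 0 < e / 2 by rewrite divr_gt0.
have [x xp xe] := quot_norm_approx p e2; have [y yq ye] := quot_norm_approx q e2.
rewrite -[in leLHS]xp -[in leLHS]yq.
have <- : quot_pi (x + y) = quot_pi x + quot_pi y by exact: piD.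
rewrite (le_trans (quot_norm_le _))// (le_trans (ler_normD _ _))//.
by rewrite [e]splitr addrACA lerD// ltW.
Qed.

Fact quot_normZ a q : quot_norm (a *: q) = `|a| * quot_norm q.
Proof.
have le b p : quot_norm (b *: p) <= `|b| * quot_norm p.
  have [->|b0] := eqVneq b 0.
    rewrite scale0r normr0 mul0r.
    have -> : 0 = quot_pi 0 by rewrite /quot_pi piE.
    by rewrite (le_trans (quot_norm_le _))// normr0.
  rewrite -ler_pdivrMl ?normr_gt0//; apply/ler_addgt0Pr => e e0.
  have [x xp xe] := quot_norm_approx p e0.
  rewrite ler_pdivrMl ?normr_gt0// -[in leLHS]xp.
  have <- : quot_pi (b *: x) = b *: quot_pi x by exact: piZ.
  by rewrite (le_trans (quot_norm_le _))// normrZ ler_wpM2l// ltW.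
apply/eqP; rewrite eq_le le/=.
have [->|a0] := eqVneq a 0.
  rewrite normr0 mul0r scale0r; apply: lb_le_inf; first exact: (has_inf_quot _).1.
  by move=> _ [x _ <-].
rewrite -[q in leLHS](scalerK a0) -ler_pdivlMl ?normr_gt0//.
by rewrite -normfV; exact: le.
Qed.

Fact quot_norm0_eq0 q : quot_norm q = 0 -> q = 0.
Proof.
move=> q0; rewrite -[q]quot_piK.
have -> : 0 = quot_pi 0 by rewrite /quot_pi piE.
apply/quot_piP; rewrite subr0; apply: csub_closed => B.
move=> /nbhs_ballP[e /= e0 eB].
have [x xq] := quot_norm_approx q e0; rewrite q0 add0r => xe.
exists (repr (q : Q) - x); split.
  by apply/quot_piP; rewrite reprK; exact/esym.
by apply: eB; rewrite -ball_normE /= opprB addrC subrK.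
Qed.

HB.instance Definition _ :=
  Lmodule_isNormed.Build R quot_space quot_normD quot_normZ quot_norm0_eq0.

End Quotient.

Section SubspaceQuotient.
Context {R : realType} {E : normedModType R} (U V : csub E).

Fact csub_in_closed : closed (@csub_val R E U @^-1` csub_set V).
Proof.
apply: preimage_closed (csub_closed (c := V)) => x _.
have /asboolP[_ cv] := csub_val_bounded U; exact: cv.
Qed.

(* V as a subspace of U, when V is contained in U (V `&` U in general). *)
Definition csub_in : csub (csub_space U) :=
  CSub csub_in_closed (csub0 V) (fun a u v => @csubP R E V a _ _).

End SubspaceQuotient.

Section Density.
Context {T : topologicalType}.
Implicit Types E D : set T.

(* D is a dense subset of the subspace E. *)
Definition dense_in E D := D `<=` E /\ E `<=` closure D.

Definition separable E := exists2 D, countable D & dense_in E D.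

(* Cardinals have no type of their own: they are represented by sets, compared
   with [#<=] and [#=]. The density character of E is represented by a chosen
   dense subset of E of least cardinality, which exists by [densP]. *)
Definition dens E : set T :=
  xget set0 [set D | dense_in E D /\ forall D', dense_in E D' -> (D #<= D')%card].

End Density.

Lemma card_le_min {T : Type} (F : set (set T)) : F !=set0 ->
  exists2 A, F A & forall B, F B -> (A #<= B)%card.
Proof.
move=> [A0 FA0].
pose P (S : set (set T -> T)) := (forall f, S f -> forall A, F A -> A (f A)) /\
  (forall f g A, S f -> S g -> F A -> f A = g A -> f = g).
have [|S [[S1 S2] Smax]] := @Zorn_bigcup _ P.
  move=> C CP Ctot; split=> [f [S CS Sf]|f g A [S CS Sf] [S' CS' S'g]].
    exact: (CP _ CS).1.
  have [SS'|S'S] := Ctot _ _ CS CS'; first exact: (CP _ CS').2 (SS' _ Sf) S'g.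
  exact: (CP _ CS).2 Sf (S'S _ S'g).
have [[A FA AS]|/forall2NP noA] :=
    pselect (exists2 A, F A & A `<=` [set f A | f in S]).
  exists A => // B FB.
  have [/eqP->|/set0P[a0 Aa0]] := boolP (A == set0); first exact: card_ge0.
  have [f0 _ _] := AS _ Aa0.
  have /choice[h hP] : forall a, exists f, A a -> S f /\ f A = a.
    by move=> a; have [/AS[f Sf fa]|nA] := pselect (A a); [exists f|exists f0].
  have /injfunPex[g] : exists2 g : T -> T, set_fun A B g & set_inj A g.
    exists (fun a => h a B) => [a Aa|a b /set_mem Aa /set_mem Ab hab].
      by apply: S1 FB; have [] := hP a Aa.
    have [[Sa <-] [Sb <-]] := (hP a Aa, hP b Ab).
    by rewrite (S2 _ _ B Sa Sb FB hab).
  exact: inj_card_le g.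
have [a0 _] : exists a0 : T, True.
  by have [//|/existsNP[a _]] := noA A0; exists a.
have /choice[h hP] : forall A, exists a,
    F A -> A a /\ forall f, S f -> f A <> a.
  move=> A; have [FA|nFA] := pselect (F A); last by exists a0.
  have [//|/existsNP[a /not_implyP[Aa nSa]]] := noA A.
  by exists a => _; split=> // f Sf fa; apply: nSa; exists f.
exfalso; apply: (Smax (S `|` [set h])).
  split; first by move=> f Sf; left.
  by move=> /(_ h (or_intror erefl)) Sh; have [_ /(_ _ Sh)] := hP _ FA0.
split=> [f [Sf|->] A FA|f g A [Sf|->] [Sg|->] FA //].
- exact: S1 Sf _ FA.
- by have [] := hP A FA.
- exact: S2 Sf Sg FA.
- by move=> fh; have [_ /(_ _ Sf)] := hP A FA.
- by move=> /esym gh; have [_ /(_ _ Sg)] := hP A FA.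
Qed.

Lemma densP {T : topologicalType} (E : set T) :
  dense_in E (dens E) /\ forall D, dense_in E D -> (dens E #<= D)%card.
Proof.
apply: (@xgetPex _ set0 [set D | dense_in E D /\
  forall D', dense_in E D' -> (D #<= D')%card]).
have [|D ED Dmin] := @card_le_min T (dense_in E).
  by exists E; split=> //; exact: subset_closure.
by exists D.
Qed.

Definition card_lt {T U : Type} (A : set T) (B : set U) : bool :=
  (A #<= B)%card && ~~ (B #<= A)%card.

Definition card_max {T : Type} (A B : set T) : set T :=
  if (A #<= B)%card then B else A.

Section Asplund.
Context {R : realType}.

Definition weak_star_slice (E : normedModType R) (M : set (dual E)) (x : E)
    (a : R) : set (dual E) :=
  [set f | M f /\ sup [set (g x : R) | g in M] - a < f x].

Definition weak_star_dentable (E : normedModType R) :=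
  forall M : set (dual E), M !=set0 -> bounded_set M ->
  forall e : R, 0 < e -> exists x a, 0 < a /\
    forall f g, weak_star_slice M x a f -> weak_star_slice M x a g ->
      `|f - g| < e.

Definition asplund (X : completeNormedModType R) := weak_star_dentable X.

(* E is linearly isometric to the linear subspace A of F. *)
Definition linearly_isometric (E F : normedModType R) (A : set F) :=
  exists T : {linear E -> F}, (forall x, `|T x| = `|x|) /\ range T = A.

End Asplund.

(* Up to isomorphism these are the nonzero limit ordinals gamma. When 0 is
   dropped, the remaining indices 1 <= alpha < gamma still have order type
   gamma. *)
Definition limit_order d (I : orderType d) :=
  [/\ wochoice.well_order (<=%O : rel I), inhabited I
    & forall i : I, exists j : I, (i < j)%O].

(* Main.v *)
Require Import Defs.
From HB Require Import structures.
From mathcomp Require Import all_boot all_order all_algebra.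
From mathcomp Require Import generic_quotient ring_quotient.
From mathcomp Require wochoice.
From mathcomp Require Import all_classical all_reals all_analysis.
Set Implicit Arguments.
Unset Strict Implicit.
Unset Printing Implicit Defensive.
Import Order.TTheory GRing.Theory Num.Theory.
Import numFieldNormedType.Exports.
Local Open Scope classical_set_scope.
Local Open Scope card_scope.
Local Open Scope ring_scope.

(** Weak-star dentability lets the dual unit ball be used up by small slices:
    for each [e > 0], slices of norm diameter less than [e] are removed from it
    one after the other, transfinitely, until nothing is left. Let [g] be a
    functional of norm at most one on a closed subspace [V], and let [K] be the
    weak-star compact set of its extensions of norm at most one. By compactness
    there is a last stage of the removal that meets [K], and what is left of [K]
    there lies in the slice removed next. By compactness again, that stage is
    already determined by finitely many of the half-spaces that cut out [K].
    So attach to each finite list of half-spaces a point of the last stage that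
    it reaches: for a suitable list, this point is [e]-close to an extension of
    [g] ([slice_pick_finite]). Hence the points attached to the lists over [V],
    for [e = 1 / n], restrict to a norm dense subset of the dual ball of [V], for
    every [V] whatsoever. This is the heart of the proof; it replaces the
    boundary theorems (James, Simons) by two applications of compactness.

    These points must depend on [V] in a continuous way. Therefore the directions
    of the half-spaces are not taken in [V] but among the values on [V] of
    countably many locally constant partial maps that approximate the identity;
    they come from the paracompactness of the norm topology
    ([locally_constant_approximations]). The resulting operator [G]
    ([exists_generator]) sees only finitely many points of its argument at a time
    and does not distinguish a set from its closure, so that it commutes with
    closures of directed unions.

    The partner of [V] is the closure of the rational span of [G V], and the
    family consists of the rich subspaces: those nonzero [V] that norm this
    rational span. For a rich [V], restriction to [V] is isometric on the partner
    by definition, and onto since its range is dense and complete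
    ([restr_partner_surj]). As the partner is defined from [V] by a monotone and
    continuous operator, inclusions of subspaces give inclusions of partners, and
    the family and the partners pass to closures of directed unions
    ([rich_directed]). Each infinite set lies in a rich subspace of density at
    most its cardinality ([exists_rich]), by closing off under countably many operations.

    The rest is duality. The kernel of the projection [P] attached to [V] is the
    annihilator of [V], so that the range of its adjoint is the bipolar of [V],
    which is its weak-star closure ([weak_star_closure]); and for [V] contained
    in [U] the difference of the projections maps onto the functionals of the
    partner of [U] that vanish on [V], that is, onto a copy of the dual of
    [U / V] ([projB_isometric]). *)

(** * Cardinal arithmetic *)

Lemma card_le_inj {T U : Type} (A : set T) (B : set U) (f : T -> U) :
  set_fun A B f -> (forall x y, A x -> A y -> f x = f y -> x = y) -> A #<= B.
Proof.
move=> fAB finj; have /injfunPex[g] : exists2 g : T -> U, set_fun A B g & set_inj A g.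
  by exists f => // x y /set_mem Ax /set_mem Ay; exact: finj.
exact: inj_card_le g.
Qed.

Lemma card_le_ex_inj {T U : Type} (A : set T) (B : set U) : A #<= B -> B !=set0 ->
  exists2 f : T -> U, set_fun A B f &
    forall x y, A x -> A y -> f x = f y -> x = y.
Proof.
move=> AB [b Bb]; pose U' : pointedType :=
  HB.pack U (isPointed.Build U b) (gen_eqMixin U) (gen_choiceMixin U).
have /pcard_leP[f] : A #<= (B : set U') by [].
exists f; first exact: funS.
by move=> x y Ax Ay /inj; apply; exact/mem_set.
Qed.

Lemma card_le_surj {T U : Type} (A : set T) (B : set U) (f : T -> U) :
  (forall y, B y -> exists2 x, A x & f x = y) -> B #<= A.
Proof.
move=> fAB; apply: card_le_trans (card_image_le f A).
by apply: subset_card_le => y /fAB[x Ax <-]; exists x.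
Qed.

(** The least cardinality in the pair [A], [B] is attained. *)
Lemma card_le_total {T : Type} (A B : set T) : A #<= B \/ B #<= A.
Proof.
have [|C [->|->] CP] := @card_le_min T [set A; B]; first by exists A; left.
- by left; apply: CP; right.
- by right; apply: CP; left.
Qed.

Lemma infinite_card_le {T U : Type} (A : set T) (B : set U) :
  infinite_set A -> A #<= B -> infinite_set B.
Proof. by move=> iA AB fB; apply: iA; exact: card_le_finite AB fB. Qed.

Lemma countable_le_infinite {T U : Type} (A : set T) (B : set U) :
  countable A -> infinite_set B -> A #<= B.
Proof. by move=> cA /infiniteP; exact: card_le_trans. Qed.

Section SquareOfInfinite.
Variables (T : Type) (A : set T).
Hypothesis Ainf : infinite_set A.

(** A subset [D] of [A] together with an injection of [D * D] into [D] is encoded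
    by the graph of the injection, from which [D] is recovered as the set of
    points [x] such that [(x, x)] has an image. Chains of such pairs are thus
    chains of graphs, with union as supremum. *)
Let dom (G : set (T * T * T)) : set T := [set x | exists z, G (x, x, z)].

Let good (G : set (T * T * T)) :=
  [/\ dom G `<=` A,
      (forall x y, dom G x -> dom G y -> exists z, G (x, y, z)),
      (forall x y z, G (x, y, z) -> [/\ dom G x, dom G y & dom G z]) &
      (forall x y x' y' z, G (x, y, z) -> G (x', y', z) -> x = x' /\ y = y')].


Let good_nat : exists2 G, good G & infinite_set (dom G).
Proof.
have [e eA einj] := card_le_ex_inj ((infiniteP A).1 Ainf) (infinite_setN0 Ainf).
pose G : set (T * T * T) :=
  [set t | exists i j, t = (e i, e j, e (pickle (i, j)))].
have domG : dom G = range e.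
  apply/seteqP; split=> [x [z [i [j [-> _ _]]]]|_ [i _ <-]]; first by exists i.
  by exists (e (pickle (i, i))), i, i.
have einj' i j : e i = e j -> i = j by exact: einj.
exists G; first split.
- by rewrite domG => _ [i _ <-]; exact: eA.
- rewrite domG => _ _ [i _ <-] [j _ <-].
  by exists (e (pickle (i, j))), i, j.
- rewrite domG => x y z [i [j [-> -> ->]]].
  by split; [exists i|exists j|exists (pickle (i, j))].
- move=> x y x' y' z [i [j [-> -> ->]]] [i' [j' [-> -> /einj']]].
  by move=> /(pcan_inj pickleK)[-> ->].
- rewrite domG; apply/infiniteP.
  by apply: (@card_le_inj _ _ _ _ e) => [i _|i j _ _ /einj'//]; exists i.
Qed.

(** The injection extends to the union of [D] and a disjoint copy [e @` D]: the
    three new quarters of the square are sent into the copy, and are told apart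
    there by three distinct tags. *)
Let good_extend G : good G -> infinite_set (dom G) ->
  dom G #<= A `\` dom G -> exists2 G', good G' & G `<` G'.
Proof.
move=> [GA Gtot Gdom Ginj] Ginf Gle; set D := dom G in GA Gtot Gdom Ginf Gle.
have [n nD ninj] := card_le_ex_inj ((infiniteP D).1 Ginf) (infinite_setN0 Ginf).
have ninj' i j : n i = n j -> i = j by exact: ninj.
have [d0 Dd0] := infinite_setN0 Ginf.
have AD0 : A `\` D !=set0.
  by apply: infinite_setN0; apply: infinite_card_le Gle.
have [e eA einj] := card_le_ex_inj Gle AD0.
have /choice[j jG] : forall p : T * T, exists z, D p.1 -> D p.2 -> G (p, z).
  move=> [x y] /=; have [Dx|] := pselect (D x); last by exists x.
  have [Dy|] := pselect (D y); last by exists x.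
  by have [z Gz] := Gtot _ _ Dx Dy; exists z.
have jD p : D p.1 -> D p.2 -> D (j p).
  by case: p => x y Dx Dy; have [_ _] := Gdom _ _ _ (jG (x, y) Dx Dy).
have jinj x y x' y' : D x -> D y -> D x' -> D y' -> j (x, y) = j (x', y') ->
    x = x' /\ y = y'.
  move=> Dx Dy Dx' Dy' jj; apply: (Ginj _ _ _ _ (j (x, y))).
    exact: (jG (x, y)).
  by rewrite jj; exact: (jG (x', y')).
pose em (b : bool) x := if b then e x else x.
have em_inj b b' x x' : D x -> D x' -> em b x = em b' x' -> b = b' /\ x = x'.
  case: b b' => -[] Dx Dx' /=; first by move/(einj _ _ Dx Dx').
  - by move=> ex; case: (eA _ Dx); rewrite ex.
  - by move=> ex; case: (eA _ Dx'); rewrite -ex.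
  - by [].
pose tg (b c : bool) := (b + c.*2)%N.
pose new : set (T * T * T) := [set t | exists x y (b c : bool),
  [/\ D x, D y, b || c & t = (em b x, em c y, e (j (j (x, y), n (tg b c))))]].
have enew x y (b c : bool) : D x -> D y -> D (j (j (x, y), n (tg b c))).
  by move=> Dx Dy; exact: (jD (_, _) (jD (x, y) Dx Dy) (nD _ I)).
have domGn : dom (G `|` new) = D `|` e @` D.
  apply/seteqP; split=> [x [z [Gz|]]|x].
  - by left; exists z.
  - move=> [u [v [b [c [Du Dv bc [-> _ _]]]]]].
    by case: b bc => _ /=; [right; exists u|left].
  move=> [[z Gz]|[u Du <-]]; first by exists z; left.
  by exists (e (j (j (u, u), n (tg true true)))); right; exists u, u, true, true.
have Dne x : D x -> ~ D (e x) by move=> /eA[].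
exists (G `|` new); last first.
  split=> [t Gt|/(_ (e d0, e d0, e (j (j (d0, d0), n (tg true true)))))].
    by left.
  move=> H; have : D (e d0).
    have [|//] := Gdom _ _ _ (H _).
    by right; exists d0, d0, true, true.
  exact: Dne.
split; rewrite ?domGn.
- by move=> x [/GA//|[u /eA[+ _] <-]].
- have mk x : (D `|` e @` D) x -> exists b u, D u /\ x = em b u.
    by move=> [Dx|[u Du <-]]; [exists false, x|exists true, u].
  move=> _ _ /mk[b [u [Du ->]]] /mk[c [v [Dv ->]]].
  have [bc|] := boolP (b || c); last first.
    rewrite negb_or; case: b; case: c => //= _.
    by have [z Gz] := Gtot _ _ Du Dv; exists z; left.
  by exists (e (j (j (u, v), n (tg b c)))); right; exists u, v, b, c.
- move=> x y z [/Gdom[Dx Dy Dz]|]; first by split; left.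
  have emD b u : D u -> (D `|` e @` D) (em b u).
    by case: b => Du; [right; exists u|left].
  move=> [u [v [b [c [Du Dv bc [-> -> ->]]]]]]; split; [exact: emD..|].
  by right; eexists; first exact: (enew u v b c Du Dv).
- move=> x y x' y' z [Gz|[u [v [b [c [Du Dv bc [-> -> ->]]]]]]]
    [Gz'|[u' [v' [b' [c' [Du' Dv' bc' [-> -> ez]]]]]]].
  + exact: Ginj Gz Gz'.
  + by have [_ _] := Gdom _ _ _ Gz; rewrite ez => /(Dne _ (enew _ _ _ _ Du' Dv')).
  + by have [_ _] := Gdom _ _ _ Gz' => /(Dne _ (enew _ _ _ _ Du Dv)).
  + have := einj _ _ (enew u v b c Du Dv) (enew u' v' b' c' Du' Dv') ez.
    move=> /(jinj _ _ _ _ (jD (_, _) Du Dv) (nD _ I) (jD (_, _) Du' Dv') (nD _ I))[].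
    move=> /(jinj _ _ _ _ Du Dv Du' Dv')[-> ->] /ninj'.
    by case: b bc {ez}; case: c; case: b' bc'; case: c'.
Qed.

Let good_bigcup (F : set (set (T * T * T))) :
  F `<=` good -> total_on F subset -> good (\bigcup_(G in F) G).
Proof.
move=> Fg Ft; split.
- by move=> x [z [G FG Gz]]; have [+ _ _ _] := Fg _ FG; apply; exists z.
- move=> x y [z [G FG Gz]] [z' [G' FG' Gz']].
  have [GG'|GG'] := Ft _ _ FG FG'.
    have [_ Gtot _ _] := Fg _ FG'.
    have [w Gw] := Gtot x y (ex_intro _ z (GG' _ Gz)) (ex_intro _ z' Gz').
    by exists w, G'.
  have [_ Gtot _ _] := Fg _ FG.
  have [w Gw] := Gtot x y (ex_intro _ z Gz) (ex_intro _ z' (GG' _ Gz')).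
  by exists w, G.
- move=> x y z [G FG Gz]; have [_ _ /(_ _ _ _ Gz)[Dx Dy Dz] _] := Fg _ FG.
  by move: Dx Dy Dz => [a Ga] [b Gb] [c Gc]; split;
    [exists a|exists b|exists c]; exists G.
- move=> x y x' y' z [G FG Gz] [G' FG' Gz'].
  have [GG'|GG'] := Ft _ _ FG FG'.
    by have [_ _ _ /(_ x y x' y' z)] := Fg _ FG'; apply => //; exact: GG'.
  by have [_ _ _ /(_ x y x' y' z)] := Fg _ FG; apply => //; exact: GG'.
Qed.

(** When the injection of [D * D] into [D] is maximal, the complement of [D] in [A]
    has no room for a copy of [D], so that [A] injects into two copies of [D],
    hence into [D * D] and into [D]. *)
Lemma card_square_infinite : A `*` A #<= A.
Proof.
have [G0 G0good G0inf] := good_nat.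
(* The first clause keeps the empty graph and the one-point graphs, which need
   not extend, from being maximal. *)
have [|G [[G0G Ggood] Gmax]] := @Zorn_bigcup _
    [set G | (G !=set0 -> G0 `<=` G) /\ good G].
  move=> F FP Ft; split.
    move=> [t [G FG Gt]] u /((FP _ FG).1 (ex_intro _ t Gt)) Gu; by exists G.
  by apply: good_bigcup => // G /FP[].
have Gn0 : G !=set0.
  apply/set0P/eqP => G00.
  have [x [z G0z]] := infinite_setN0 G0inf.
  apply: (Gmax G0 _ (conj _ G0good)) => [|_]; last exact: subset_refl.
  by rewrite G00; split=> [t []|/(_ _ G0z)].
have Ginf : infinite_set (dom G).
  by apply: sub_infinite_set G0inf => x [z /(G0G Gn0) Gz]; exists z.
have DD : dom G `*` dom G #<= dom G.
  have [_ Gtot Gdom Ginj] := Ggood.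
  have [d0 _] := infinite_setN0 Ginf.
  have /choice[j jG] : forall p : T * T, exists z, dom G p.1 -> dom G p.2 -> G (p, z).
    move=> [x y] /=; have [Dx|] := pselect (dom G x); last by exists x.
    have [Dy|] := pselect (dom G y); last by exists x.
    by have [z Gz] := Gtot _ _ Dx Dy; exists z.
  apply: (@card_le_inj _ _ _ _ j) => [[x y] [Dx Dy]|].
    by have [] := Gdom _ _ _ (jG (x, y) Dx Dy).
  move=> [x y] [x' y'] [Dx Dy] [Dx' Dy'] jj.
  have [] := Ginj x y x' y' (j (x, y)) (jG (x, y) Dx Dy).
    by rewrite jj; exact: (jG (x', y')).
  by move=> /= -> ->.
have [/(good_extend Ggood Ginf)[G' G'good GG']|AD] :=
    card_le_total (dom G) (A `\` dom G).
  exfalso; apply: (Gmax _ GG'); split=> // _.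
  exact: subset_trans (G0G Gn0) GG'.1.
suff AG : A #<= dom G.
  apply: card_le_trans (card_le_trans _ DD) _; last first.
    by apply: subset_card_le; case: Ggood.
  have [f fG finj] := card_le_ex_inj AG (infinite_setN0 Ginf).
  apply: (@card_le_inj _ _ _ _ (fun p => (f p.1, f p.2))) => [p [p1 p2]|].
    by split; exact: fG.
  by move=> [x y] [x' y'] [/= Ax Ay] [/= Ax' Ay'] [/finj-> // /finj->].
apply: card_le_trans DD.
have [f fG finj] := card_le_ex_inj AD (infinite_setN0 Ginf).
have [n nG ninj] := card_le_ex_inj ((infiniteP _).1 Ginf) (infinite_setN0 Ginf).
have n01 : n 0%N <> n 1%N by move=> /ninj => /(_ I I).
pose h x := if x \in dom G then (x, n 0%N) else (f x, n 1%N).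
apply: (@card_le_inj _ _ _ _ h) => [x Ax|x y Ax Ay]; rewrite /h.
  have [/set_mem Gx|Gx] := boolP (x \in dom G).
    by split=> //; exact: nG.
  by split; [apply: fG; split=> //; move: Gx; rewrite notin_setE|exact: nG].
case: (boolP (x \in dom G)) => Gx; case: (boolP (y \in dom G)) => Gy;
  move=> /pair_equal_spec[xy nn] //; first by case: n01.
by apply: finj xy; split=> //; [move: Gx|move: Gy]; rewrite notin_setE.
Qed.

End SquareOfInfinite.

Lemma card_le_setX {S S' T : Type} (A : set S) (A' : set S') (B : set T) :
  infinite_set B -> A #<= B -> A' #<= B -> A `*` A' #<= B.
Proof.
move=> Binf AB A'B; apply: card_le_trans (card_square_infinite Binf).
have B0 := infinite_setN0 Binf.
have [f fB finj] := card_le_ex_inj AB B0; have [g gB ginj] := card_le_ex_inj A'B B0.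
apply: (@card_le_inj _ _ _ _ (fun p => (f p.1, g p.2))) => [p [p1 p2]|].
  by split; [exact: fB|exact: gB].
by move=> [x y] [x' y'] [/= Ax Ay] [/= Ax' Ay'] [/finj-> // /ginj->].
Qed.

Lemma card_le_bigcup {I S T : Type} (D : set I) (F : I -> set S) (B : set T) :
  infinite_set B -> D #<= B -> (forall i, D i -> F i #<= B) ->
  \bigcup_(i in D) F i #<= B.
Proof.
move=> Binf DB FB; apply: card_le_trans (card_le_setX Binf DB (card_lexx B)).
have B0 := infinite_setN0 Binf.
have /choice[f fP] : forall i, exists f : S -> T, D i -> set_fun (F i) B f /\
    forall x y, F i x -> F i y -> f x = f y -> x = y.
  move=> i; have [/FB FiB|nDi] := pselect (D i).
    by have [f fB finj] := card_le_ex_inj FiB B0; exists f.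
  by have [b _] := B0; exists (fun=> b).
have [->|/set0P[x0 [i0 Di0 _]]] := eqVneq (\bigcup_(i in D) F i) set0.
  exact: card_ge0.
have /choice[i iP] : forall x, exists i, (\bigcup_(i in D) F i) x -> D i /\ F i x.
  move=> x; have [[i Di Fi]|] := pselect ((\bigcup_(i in D) F i) x); first by exists i.
  by exists i0.
apply: (@card_le_inj _ _ _ _ (fun x => (i x, f (i x) x))) => [x /iP[Dx Fx]|].
  by split=> //; have [+ _] := fP _ Dx; apply.
move=> x y /iP[Dx Fx] /iP[Dy Fy] /pair_equal_spec[ixy].
by rewrite -ixy in Fy *; have [_] := fP _ Dx; apply.
Qed.

Lemma card_le_setU {S T : Type} (A A' : set S) (B : set T) :
  infinite_set B -> A #<= B -> A' #<= B -> A `|` A' #<= B.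
Proof.
move=> Binf AB A'B; rewrite -bigcup2inE; apply: card_le_bigcup => //.
  exact: countable_le_infinite (countableP _) Binf.
by move=> [|[|i]].
Qed.

Definition lists {T : eqType} (A : set T) : set (seq T) :=
  [set s | [set` s] `<=` A].

Lemma lists_cons {T : eqType} (A : set T) x s :
  lists A (x :: s) <-> A x /\ lists A s.
Proof.
split=> [As|[Ax As] y]; rewrite /mkset.
  split=> [|y ys]; apply: As; rewrite /mkset ?mem_head//.
  by rewrite in_cons [y \in s]ys orbT.
by rewrite in_cons => /orP[/eqP->//|/As].
Qed.

Lemma lists_cat {T : eqType} (A : set T) s t :
  lists A (s ++ t) <-> lists A s /\ lists A t.
Proof.
elim: s => [|x s IH] /=; first by split=> [|[]].
by split=> [/lists_cons[Ax /IH[]]|[/lists_cons[Ax As] At]];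
  rewrite ?lists_cons//; split=> //; apply/IH.
Qed.

Lemma card_le_lists {S : eqType} {T : Type} (A : set S) (B : set T) :
  infinite_set B -> A #<= B -> lists A #<= B.
Proof.
move=> Binf AB.
have -> : lists A = \bigcup_n [set s | lists A s /\ size s = n].
  by apply/seteqP; split=> [s As|s [n _ []//]]; exists (size s).
apply: card_le_bigcup => //; first exact: countable_le_infinite (countableP _) Binf.
move=> n _; elim: n => [|n IH].
  apply: countable_le_infinite Binf; apply: sub_countable (countable1 [::]).
  by apply: subset_card_le => s [_ /size0nil].
apply: card_le_trans (card_le_setX Binf AB IH).
apply: (@card_le_surj _ _ _ _ (fun p => p.1 :: p.2)); move=> -[|x s] [As] //= [sn].
by have [Ax {}As] := (lists_cons _ _ _).1 As; exists (x, s).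
Qed.

(** * Finitary operators *)

(** Such operators preserve directed unions, and closing a set off under them does
    not raise its cardinality. *)
Definition finitary {S : eqType} {T : Type} (Psi : set S -> set T) :=
  [/\ forall A B, A `<=` B -> Psi A `<=` Psi B,
      forall A y, Psi A y -> exists2 s, lists A s & Psi [set` s] y &
      forall s : seq S, countable (Psi [set` s])].

Lemma card_le_finitary {S : eqType} {T U : Type} (Psi : set S -> set T) (A : set S) (B : set U) :
  finitary Psi -> infinite_set B -> A #<= B -> Psi A #<= B.
Proof.
move=> [_ Pfin Pcount] Binf AB.
apply: card_le_trans (_ : \bigcup_(s in lists A) Psi [set` s] #<= B).
  by apply: subset_card_le => y /Pfin[s As Psy]; exists s.
apply: card_le_bigcup (card_le_lists Binf AB) _ => // s _.
exact: countable_le_infinite (Pcount s) Binf.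
Qed.

Lemma countable_finitary {S : eqType} {T : Type} (Psi : set S -> set T) (A : set S) :
  finitary Psi -> countable A -> countable (Psi A).
Proof. by move=> Pfin; apply: card_le_finitary Pfin infinite_nat. Qed.

Lemma finitary_comp {S : eqType} {T : eqType} {U : Type} (Psi : set S -> set T)
    (Phi : set T -> set U) :
  finitary Psi -> finitary Phi -> finitary (Phi \o Psi).
Proof.
move=> fPsi fPhi; split=> [A B AB|A y|s] /=.
- by case: fPhi => mono _ _; apply: mono; case: fPsi => + _ _; exact.
- have [monoS finS _] := fPsi; have [monoT finT _] := fPhi.
  move=> /finT[t tA ty].
  suff [s sA ts] : exists2 s, lists A s & [set` t] `<=` Psi [set` s].
    by exists s => //; exact: monoT ty.
  elim: t tA {ty} => [|z t IH]; first by exists [::].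
  move=> /lists_cons[/finS[s' s'A zs'] /IH[s sA ts]].
  have [ss' s's'] := (lists_cat [set` s ++ s'] s s').1 (@subset_refl _ _).
  exists (s ++ s'); first by apply/lists_cat; split.
  apply/lists_cons; split; first exact: (monoS _ _ s's').
  
  by move=> u /ts; exact: (monoS _ _ ss').
- by apply: countable_finitary => //; case: fPsi.
Qed.

Lemma finitary_setU {S : eqType} {T : Type} (Psi Phi : set S -> set T) :
  finitary Psi -> finitary Phi -> finitary (fun A => Psi A `|` Phi A).
Proof.
move=> [m1 f1 c1] [m2 f2 c2]; split=> [A B AB|A y|s].
- by apply: setUSS; [exact: m1|exact: m2].
- by move=> [/f1|/f2][s As sy]; exists s => //; [left|right].
- exact: (card_le_setU infinite_nat (c1 s) (c2 s)).
Qed.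

Lemma finitary_bigcup {S : eqType} {T : Type} (g : S -> set T) :
  (forall x, countable (g x)) -> finitary (fun A => \bigcup_(x in A) g x).
Proof.
move=> gc; split=> [A B AB|A y [x Ax gxy]|s].
- exact: bigcup_subset.
- exists [:: x]; first by move=> z /=; rewrite inE => /eqP->.
  by exists x => //=; rewrite inE.
- by apply: bigcup_countable => //; apply: finite_set_countable; exact: finite_seq.
Qed.

Lemma finitary_lists {S : eqType} : finitary (@lists S).
Proof.
split=> [A B AB s As|A s As|s]; first exact: subset_trans AB.
  by exists s.
apply: (card_le_lists infinite_nat); apply: finite_set_countable; exact: finite_seq.
Qed.

Lemma finitary_setX {S : eqType} {T : eqType} (D : set T) :
  countable D -> finitary (fun A : set S => A `*` D).
Proof.
move=> Dc; split=> [A B AB|A [x d] [Ax Dd]|s].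
- by move=> [x d] [/AB].
- exists [:: x]; first by move=> z /=; rewrite inE => /eqP->.
  by split=> //=; rewrite inE.
- apply: countableX => //; apply: finite_set_countable; exact: finite_seq.
Qed.

(** Iterating [Phi] countably often suffices: a finite subset of the union already
    lies in one of the stages. *)
Lemma finitary_closing {S : eqType} (Phi : set S -> set S) (A : set S) :
  finitary Phi -> infinite_set A ->
  exists M, [/\ A `<=` M, M #<= A & Phi M `<=` M].
Proof.
move=> Pfin Ainf; pose M := fix M n := if n is k.+1 then M k `|` Phi (M k) else A.
have M1 n : M n `<=` M n.+1 by left.
have Mle m n : (m <= n)%N -> M m `<=` M n.
  elim: n => [|n IH]; first by rewrite leqn0 => /eqP->.
  by rewrite leq_eqVlt => /orP[/eqP->//|/IH]; move/subset_trans; apply; exact: M1.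
exists (\bigcup_n M n); split.
- by move=> x Ax; exists 0%N.
- apply: card_le_bigcup => //; first exact: countable_le_infinite (countableP _) Ainf.
  move=> n _; elim: n => [|n IH]; first exact: card_lexx.
  by apply: card_le_setU => //; exact: card_le_finitary.
- have [mono fin _] := Pfin; move=> y /fin[s sM sy].
  suff [n sn] : exists n, [set` s] `<=` M n.
    by exists n.+1 => //; right; exact: mono sy.
  elim: s sM {sy} => [|x s IH]; first by exists 0%N.
  move=> /lists_cons[[m _ xm] /IH[n sn]].
  exists (maxn m n); apply/lists_cons; split.
    by apply: Mle xm; rewrite leq_maxl.
  by move=> u /sn; apply: Mle; rewrite leq_maxr.
Qed.

(** For a directed union, each finite subset lies in one member. *)
Lemma finitary_directed {S : eqType} {T I : Type} (Psi : set S -> set T) (A : I -> set S) :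
  finitary Psi -> inhabited I ->
  (forall i j, exists k, A i `<=` A k /\ A j `<=` A k) ->
  Psi (\bigcup_i A i) = \bigcup_i Psi (A i).
Proof.
move=> [mono fin _] [i0] dir; apply/seteqP; split=> [y /fin[s sA sy]|y [i _]].
  suff [i si] : exists i, [set` s] `<=` A i by exists i => //; exact: mono sy.
  elim: s sA {sy} => [|x s IH]; first by exists i0.
  move=> /lists_cons[[j _ xj] /IH[i si]]; have [k [ik jk]] := dir i j.
  by exists k; apply/lists_cons; split; [exact: jk|move=> u /si; exact: ik].
by apply: mono => x Ax; exists i.
Qed.

(** * Hahn-Banach *)

Section HahnBanach.
Context {R : realType} {E : lmodType R} (p : E -> R).
Hypothesis pD : forall x y, p (x + y) <= p x + p y.
Hypothesis pZ : forall a x, 0 < a -> p (a *: x) = a * p x.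

(** A partially defined linear functional, given by its graph: no domain has to be
    carried along, and Zorn's lemma applies to unions of graphs. *)
Definition linear_graph (G : set (E * R)) :=
  G (0, 0) /\ forall a u v, G u -> G v -> G (a *: u.1 + v.1, a * u.2 + v.2).

Let good (G : set (E * R)) := linear_graph G /\ forall u, G u -> u.2 <= p u.1.

(** One more dimension: by subadditivity the constraints on the value [c] at [v]
    leave a nonempty interval, of which the lower end point is taken. *)
Let good_extend G v : good G -> exists2 G', good G' & G `<=` G' /\ exists r, G' (v, r).
Proof.
move=> [[G0 Glin] Gp].
have GB u w : G u -> G w -> u.2 - p (u.1 - v) <= p (w.1 + v) - w.2.
  move=> Gu Gw; rewrite lerBrDr addrAC lerBlDr.
  have := Gp _ (Glin 1 _ _ Gu Gw); rewrite /= mul1r scale1r => /le_trans; apply.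
  have -> : u.1 + w.1 = (w.1 + v) + (u.1 - v) by rewrite addrACA subrr addr0 addrC.
  exact: pD.
pose S := [set u.2 - p (u.1 - v) | u in G]; pose c := sup S.
have Sub w : G w -> ubound S (p (w.1 + v) - w.2).
  by move=> Gw _ [u Gu <-]; exact: GB.
have Ssup : has_sup S.
  by split; [exists (0 - p (0 - v)), (0, 0)|exists (p (0 + v) - 0); exact: (Sub (0, 0))].
have cl u : G u -> u.2 + c <= p (u.1 + v).
  move=> Gu; rewrite -lerBrDl; apply: ge_sup; first by case: Ssup.
  exact: Sub.
have cr u : G u -> u.2 - c <= p (u.1 - v).
  move=> Gu; rewrite lerBlDl -lerBlDr.
  by apply: (sup_upper_bound Ssup); exists u.
exists [set w | exists u t, G u /\ w = (u.1 + t *: v, u.2 + t * c)]; first split.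
- split; first by exists (0, 0), 0; split; rewrite //= scale0r mul0r !addr0.
  move=> a _ _ [u [t [Gu ->]]] [w [s [Gw ->]]] /=.
  exists (a *: u.1 + w.1, a * u.2 + w.2), (a * t + s); split; first exact: Glin.
  by rewrite /= scalerDr mulrDr scalerDl mulrDl scalerA mulrA !addrA
    ![_ + w.1]addrAC ![_ + w.2]addrAC.
- move=> _ [u [t [Gu ->]]] /=.
  have GZ (a : R) : G (a *: u.1, a * u.2).
    by have := Glin a _ _ Gu G0; rewrite /= !addr0.
  have [t0|t0|->] := ltgtP t 0; last by rewrite mul0r scale0r !addr0; exact: Gp.
    have nt0 : 0 < - t by rewrite oppr_gt0.
    have := cr _ (GZ (- t)^-1); rewrite -(ler_pM2l nt0) /= -pZ// mulrBr.
    rewrite mulrA divff ?gt_eqF// mul1r scalerBr scalerA divff ?gt_eqF//.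
    by rewrite scale1r mulNr opprK scaleNr opprK.
  have := cl _ (GZ t^-1); rewrite -(ler_pM2l t0) /= -pZ// mulrDr.
  by rewrite mulrA divff ?gt_eqF// mul1r scalerDr scalerA divff ?gt_eqF// scale1r.
split; first by move=> [x r] Gu; exists (x, r), 0; split=> //=; rewrite scale0r mul0r !addr0.
by exists c, (0, 0), 1; split; rewrite //= scale1r mul1r !add0r.
Qed.

(** That a maximal graph is single-valued also follows from domination by [p]:
    a value at [0] is at most [p 0 = 0], and so is its opposite. *)
Lemma hahn_banach (G : set (E * R)) :
  linear_graph G -> (forall u, G u -> u.2 <= p u.1) ->
  exists f : E -> R, [/\ forall a x y, f (a *: x + y) = a * f x + f y,
    forall x, f x <= p x & forall u, G u -> f u.1 = u.2].
Proof.
move=> Glin Gp.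
(* The empty graph is admitted as the union of the empty chain. *)
have [|H [GH Hmax]] := @Zorn_bigcup _ [set H | H !=set0 -> G `<=` H /\ good H].
  move=> F FP Ft [u [H FH Hu]].
  have Hg K w : F K -> K w -> G `<=` K /\ good K.
    by move=> FK Kw; apply: (FP _ FK); exists w.
  split; first by move=> w Gw; exists H => //; exact: (Hg _ _ FH Hu).1.
  split; last by move=> w [K FK Kw]; have [_ [_]] := Hg _ _ FK Kw; exact.
  split; first by exists H => //; have [_ [[]]] := Hg _ _ FH Hu.
  move=> a w z [K FK Kw] [L FL Lz].
  have [KL|LK] := Ft _ _ FK FL.
    by exists L => //; have [_ [[_ +] _]] := Hg _ _ FL Lz; apply=> //; exact: KL.
  by exists K => //; have [_ [[_ +] _]] := Hg _ _ FK Kw; apply=> //; exact: LK.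
have H0 : H !=set0.
  apply/set0P/eqP => H0; suff HG : H `<` G.
    exact: (Hmax G HG (fun _ => conj (@subset_refl _ G) (conj Glin Gp))).
  by rewrite H0; split=> [?//|/(_ _ Glin.1)].
have [Hn [[H00 Hlin] Hp]] := GH H0.
have Hdom x : exists r, H (x, r).
  have [H' H'good [HH' [r H'r]]] := good_extend x (conj (conj H00 Hlin) Hp).
  exists r; have [//|nH'H] := pselect (H' `<=` H); first exact.
  exfalso; apply: (Hmax H'); first by [].
  by move=> _; split=> //; exact: subset_trans HH'.
have Hfun x r s : H (x, r) -> H (x, s) -> r = s.
  suff le r' s' : H (x, r') -> H (x, s') -> r' <= s'.
    by move=> Hr Hs; apply/eqP; rewrite eq_le !le.
  have p00 : p 0 = 0.
    have := @pZ 2 0 (ltr0Sn _ 1); rewrite scaler0 mulr_natl mulr2n => /eqP.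
    by rewrite -subr_eq0 opprD addNKr oppr_eq0 => /eqP.
  move=> Hr Hs; have := Hp _ (Hlin (-1) _ _ Hs Hr).
  by rewrite /= scaleN1r addNr mulN1r p00 addrC subr_le0.
have [f fH] := choice Hdom.
exists f; split=> [a x y|x|[x r] /Hn Hr].
- exact: Hfun (fH _) (Hlin _ _ _ (fH x) (fH y)).
- exact: (Hp (x, f x)).
- exact: Hfun (fH x) Hr.
Qed.

End HahnBanach.

Section DualFacts.
Local Open Scope quotient_scope.
Context {R : realType}.
Implicit Types E : normedModType R.

Lemma dual_of_linear E (f : E -> R) (M : R) :
  (forall a x y, f (a *: x + y) = a * f x + f y) ->
  (forall x, f x <= M * `|x|) -> 0 <= M ->
  exists2 g : dual E, (forall x, g x = f x) & `|g| <= M.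
Proof.
move=> flin fM M0.
have f0 : f 0 = 0 by have := flin (-1) 0 0; rewrite scaler0 addr0 mulN1r addNr.
have fN x : f (- x) = - f x.
  by have := flin (-1) x 0; rewrite scaleN1r addr0 mulN1r f0 addr0.
have fM' x : `|f x| <= M * `|x|.
  by rewrite ler_norml fM andbT lerNl -fN -normrN fM.
have fb : (f : E -> R^o) \in bounded_linear.
  by apply/bounded_linearP; split; [exact: flin|exists M].
exists (Bop fb) => //; apply: op_norm_le => x x1.
by apply: le_trans (fM' x) _; rewrite ler_piMr.
Qed.

Lemma dual_ext E (V : csub E) (g : dual (csub_space V)) :
  exists2 f : dual E, restr V f = g & `|f| <= `|g|.
Proof.
have [||||f [flin fp fg]] := @hahn_banach R E (fun x => `|g| * `|x|) _ _
  [set u | exists y : csub_space V, u = (csub_val y, g y)].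
- by move=> x y; rewrite -mulrDr ler_wpM2l// ler_normD.
- by move=> a x a0; rewrite normrZ gtr0_norm// mulrCA.
- split; first by exists 0; rewrite linear0.
  by move=> a _ _ [y ->] [z ->] /=; exists (a *: y + z); rewrite linearP.
- move=> _ [y ->] /=; apply: le_trans (ler_norm _) _; exact: (ler_op_norm g y).
have [h hf hM] := dual_of_linear flin fp (normr_ge0 g).
exists h => //; apply/val_inj/funext => y.
by rewrite -[LHS]/(h (csub_val y)) hf (fg (csub_val y, g y))//; exists y.
Qed.

Lemma dual_norming E (x : E) : exists2 f : dual E, f x = `|x| & `|f| <= 1.
Proof.
have [||||f [flin fp fg]] := @hahn_banach R E (fun x => 1 * `|x|) _ _
  [set u | exists t : R, u = (t *: x, t * `|x|)].
- by move=> y z; rewrite -mulrDr ler_wpM2l// ler_normD.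
- by move=> a y a0; rewrite normrZ gtr0_norm// mulrCA.
- split; first by exists 0; rewrite scale0r mul0r.
  move=> a _ _ [t ->] [s ->] /=; exists (a * t + s).
  by rewrite scalerA mulrA -scalerDl -mulrDl.
- by move=> _ [t ->] /=; rewrite mul1r normrZ ler_wpM2r// ler_norm.
have [h hf h1] := dual_of_linear flin fp ler01.
exists h => //; rewrite hf.
by have := fg (1 *: x, 1 * `|x|); rewrite /= scale1r mul1r; apply; exists 1; rewrite scale1r mul1r.
Qed.

Lemma quot_pi_is_linear E (V : csub E) : linear (@quot_pi R E V).
Proof.
move=> a x y.
have -> : quot_pi V (a *: x + y) = quot_pi V (a *: x) + quot_pi V y.
  by rewrite /quot_pi piE.
congr (_ + _).
rewrite -[RHS]/(quot_pi V (a *: repr (quot_pi V x : Quotient.quot (csub_pred V)))).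
apply/quot_piP; rewrite -scalerBr -[a *: _]addr0; apply: csubP (csub0 _).
by apply/quot_piP; rewrite /quot_pi reprK.
Qed.

Lemma quot_pi_norm_le E (V : csub E) x : `|@quot_pi R E V x| <= `|x|.
Proof. by apply: ge_inf; [by exists 0 => _ [y _ <-]|exists x]. Qed.

Lemma quot_norm_approx E (V : csub E) (q : quot_space V) (e : R) : 0 < e ->
  exists2 x, quot_pi V x = q & `|x| < `|q| + e.
Proof.
move=> e0; have [|_ [x xq <-]] := inf_adherent e0 (_ : has_inf [set `|x| | x in [set x | quot_pi V x = q]]); last by exists x.
split; last by exists 0 => _ [y _ <-].
by exists `|repr q|, (repr q) => //; exact: reprK.
Qed.

Fact quot_pi_bounded E (V : csub E) : @quot_pi R E V \in bounded_linear.
Proof.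
apply/bounded_linearP; split; first exact: quot_pi_is_linear.
by exists 1 => x; rewrite mul1r quot_pi_norm_le.
Qed.

Definition quot_map E (V : csub E) : bop E (quot_space V) := Bop (quot_pi_bounded V).

(** Separation from [V] is norming the class of [x] in the quotient by [V]. *)
Lemma dual_separation E (V : csub E) (x : E) : ~ (V : set E) x ->
  exists2 f : dual E, (forall y, (V : set E) y -> f y = 0) & f x != 0.
Proof.
move=> nVx; have [g gx _] := dual_norming (quot_map V x).
have pi0 y : (quot_map V y = 0) <-> (V : set E) y.
  by rewrite -(linear0 (quot_map V)) -[X in _ <-> csub_set V X]subr0; exact: quot_piP.
exists (adjoint (quot_map V) g).
  by move=> y /pi0 y0; rewrite -[LHS]/(g (quot_map V y)) y0 linear0.
rewrite -[X in X != 0]/(g (quot_map V x)) gx normr_eq0.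
by apply/eqP => /pi0.
Qed.

End DualFacts.

(** * Weak-star compactness *)

Lemma closed_ptws_linear (R : realType) (E : normedModType R) (a : R) (x y : E) :
  closed [set q : prod_topology (fun _ : E => R^o) | q (a *: x + y) = a * q x + q y].
Proof.
set T := prod_topology _.
have ev (z : E) : continuous (fun q : T => q z : R^o).
  exact: proj_continuous.
have -> : [set q : T | q (a *: x + y) = a * q x + q y] =
    (fun q : T => q (a *: x + y) - (a *: (q x : R^o) + q y) : R^o) @^-1` [set r | r = 0].
  by apply/seteqP; split=> q /= => [->|/subr0_eq//]; rewrite subrr.
apply: preimage_closed; last exact: (@closed_eq R 0).
move=> q _.
have H := @cvgZl_tmp R R^o T (nbhs q) (nbhs_filter q) a (fun q => q x) (q x) (ev x q).
have H2 := @cvgD R R^o T (nbhs q) (nbhs_filter q) _ _ _ _ H (ev y q).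
have H3 := @cvgB R R^o T (nbhs q) (nbhs_filter q) _ _ _ _ (ev _ q) H2.
exact: H3.
Qed.

Section Polytopes.
Context {R : realType} {E : normedModType R}.
Implicit Types (S : set (E * R)) (f : dual E).

(** Weak-star closed convex subsets of the ball are handled through systems of
    half-spaces [f x <= a], so that compactness concerns finite subsystems. *)
Definition sat S : set (dual E) :=
  [set f : dual E | `|f| <= 1 /\ forall c, S c -> f c.1 <= c.2].

Lemma sat_subset S S' : S `<=` S' -> sat S' `<=` sat S.
Proof. by move=> SS' f [f1 fS']; split=> // c /SS'/fS'. Qed.

(** Weak-star compactness of the dual ball: a cluster point of the filter of finite
    subsystems, which exists by Tychonoff's theorem, satisfies each half-space
    condition and is linear. *)
Lemma sat_compact S : (forall s, lists S s -> sat [set` s] !=set0) ->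
  sat S !=set0.
Proof.
move=> Sfin; pose T := prod_topology (fun _ : E => R^o).
pose F : set_system T :=
  [set C | exists2 s, lists S s & forall f, sat [set` s] f -> C (f : E -> R)].
have FF : ProperFilter F.
  split; first by move=> [s Ss s0]; have [f /s0] := Sfin s Ss.
  split; first by exists [::].
  - move=> C D [s Ss sC] [t St tD]; exists (s ++ t); first exact/lists_cat.
    have [sst tst] := (lists_cat [set` s ++ t] s t).1 (@subset_refl _ _).
    by move=> f fst; split; [apply: sC|apply: tD]; apply: sat_subset fst.
  - by move=> C D CD [s Ss sC]; exists s => // f /sC/CD.
have cpt : compact [set p : T | forall x, [set` `[- `|x|, `|x|]] (p x)].
  apply: (@tychonoff E (fun=> R^o) (fun x => [set` `[- `|x|, `|x|]])) => x.
  exact: segment_compact.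
have [|p [pbox pF]] := cpt F FF.
  exists [::] => // f [f1 _] x; rewrite /= in_itv /= -ler_norml.
  by apply: le_trans (ler_op_norm f x) _; rewrite ler_piMl.
have pcl (C : set T) : closed C -> F C -> C p.
  by move=> Ccl FC; apply: Ccl => B pB; exact: pF.
have ev (x : E) : continuous (fun q : T => q x : R^o) by exact: proj_continuous.
have plin a x y : p (a *: x + y) = a * p x + p y.
  apply: (pcl _ (@closed_ptws_linear R E a x y)).
  by exists [::] => // f _ /=; rewrite linearP.
have [|g gp g1] := dual_of_linear (M := 1) plin _ ler01.
  by move=> x; have := pbox x; rewrite /= in_itv /= mul1r => /andP[].
exists g; split=> // c Sc; rewrite gp.
apply: (pcl [set q : T | q c.1 <= c.2]).
  apply: (@preimage_closed T R^o (fun q => q c.1) [set r | r <= c.2]).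
      by move=> q _; exact: ev.
  exact: (@closed_le R c.2).
exists [:: c]; first exact/lists_cons.
by move=> f [_]; apply; rewrite /mkset mem_head.
Qed.

End Polytopes.

(** * Exhausting the dual ball by small slices *)

Section Tower.
Context {T : Type} (next : set T -> T).

(** The transfinite iteration of [S |-> S `|` [set next S]], without ordinals; it
    starts from the empty set, the union of the empty family. *)
Inductive tower : set T -> Prop :=
| tower_step S : tower S -> tower (S `|` [set next S])
| tower_bigcup (C : set (set T)) : (forall S, C S -> tower S) -> tower (\bigcup_(S in C) S).

Let step S := S `|` [set next S].

(** The intermediate notion of the Bourbaki-Witt argument: such an [S] is comparable
    with each stage, and by induction each stage is such an [S]. *)
Let extreme S := forall S', tower S' -> S' `<=` S -> S' <> S -> step S' `<=` S.

Let extreme_linear S : extreme S -> forall S', tower S' ->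
  S' `<=` S \/ step S `<=` S'.
Proof.
move=> Sext S'; elim=> [{}S' TS' [S'S|SS']|C TC IH].
- have [->|S'nS] := pselect (S' = S); first by right.
  by left; exact: Sext.
- by right; apply: subset_trans SS' _; left.
have [[D CD SD]|nSD] := pselect (exists2 D, C D & step S `<=` D).
  by right=> t /SD Dt; exists D.
left=> t [D CD Dt]; have [DS|SD] := IH _ CD; first exact: DS.
by case: nSD; exists D.
Qed.

Let tower_extreme S : tower S -> extreme S.
Proof.
elim=> [{}S TS Sext|C TC Cext] S' TS' S'S nS'.
  have [S'S1|SS'] := extreme_linear Sext TS'; last first.
    by case: nS'; apply/seteqP; split.
  have [->//|nS'S] := pselect (S' = S).
  by apply: subset_trans (Sext _ TS' S'S1 nS'S) _; left.
have [[D [CD S'D]]|nD] := pselect (exists D, C D /\ S' `<=` D); last first.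
  case: nS'; apply/seteqP; split=> // t [D CD Dt].
  have [S'D|DS'] := extreme_linear (Cext _ CD) TS'; first by case: nD; exists D.
  by apply: DS'; left.
have [S'D'|nS'D] := pselect (S' = D); last first.
  by move=> t /(Cext _ CD _ TS' S'D nS'D) Dt; exists D.
have [D' [CD' nD']] : exists D', C D' /\ ~ D' `<=` S'.
  apply: contrapT => nD'; apply: nS'; apply/seteqP; split=> // t [D' CD' D't].
  apply: contrapT => nS't; apply: nD'; exists D'; split=> // D'S'.
  by apply: nS't; exact: D'S'.
have S'ext : extreme S' by rewrite S'D'; exact: Cext.
have [//|S'D''] := extreme_linear S'ext (TC _ CD').
by move=> t /S'D'' D't; exists D'.
Qed.

Lemma tower_linear S S' : tower S -> tower S' ->
  S' `<=` S \/ S `|` [set next S] `<=` S'.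
Proof. by move=> /tower_extreme Sext; exact: extreme_linear. Qed.

Lemma tower_total S S' : tower S -> tower S' -> S `<=` S' \/ S' `<=` S.
Proof.
move=> TS TS'; have [|SS'] := tower_linear TS TS'; first by right.
by left; apply: subset_trans SS'; left.
Qed.

End Tower.

Section Dentability.
Context {R : realType} {E : normedModType R}.
Hypothesis E_dentable : weak_star_dentable E.
Implicit Types (S : set (E * R)) (f : dual E).

(** Dentability, with a slice described by the half-space that removes it. *)
Lemma small_slice (e : R) : 0 < e ->
  exists next : set (E * R) -> E * R, forall S, sat S !=set0 ->
    (exists2 f, sat S f & (next S).2 < f (next S).1) /\
    forall f g, sat S f -> (next S).2 < f (next S).1 ->
      sat S g -> (next S).2 < g (next S).1 -> `|f - g| < e.
Proof.
move=> e0.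
suff /choice[next nextP] : forall S, exists c : E * R, sat S !=set0 ->
    (exists2 f, sat S f & c.2 < f c.1) /\
    forall f g, sat S f -> c.2 < f c.1 -> sat S g -> c.2 < g c.1 -> `|f - g| < e.
  by exists next.
move=> S; have [S0|] := pselect (sat S !=set0); last by exists (0, 0).
have Sbd : bounded_set (sat S).
  by exists 1; split=> // M M1 f [f1 _]; exact: le_trans f1 (ltW M1).
have [x [a [a0 sliceP]]] := E_dentable S0 Sbd e0.
exists (x, sup [set (g x : R) | g in sat S] - a) => _; split; last first.
  by move=> f g Sf fa Sg ga; apply: sliceP; split.
have supP : has_sup [set (g x : R) | g in sat S].
  have [f0 Sf0] := S0; split; first by exists (f0 x), f0.
  exists `|x| => _ [g [g1 _] <-]; apply: le_trans (ler_norm _) _.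
  by apply: le_trans (ler_op_norm g x) _; rewrite ler_piMl.
by have [_ [f Sf <-] fa] := sup_adherent a0 supP; exists f.
Qed.

Variables (e : R) (next : set (E * R) -> E * R).
Hypothesis nextP : forall S, sat S !=set0 ->
    (exists2 f, sat S f & (next S).2 < f (next S).1) /\
    forall f g, sat S f -> (next S).2 < f (next S).1 ->
      sat S g -> (next S).2 < g (next S).1 -> `|f - g| < e.

(** The stages of the exhaustion are the sets [sat S'] for [S'] in the tower, which
    shrink as [S'] grows; [rank S] is the last stage that meets [sat S]. *)
Definition rank S : set (E * R) :=
  \bigcup_(S' in [set S' | tower next S' /\ sat (S `|` S') !=set0]) S'.

Lemma tower_rank S : tower next (rank S).
Proof. by apply: tower_bigcup => S' []. Qed.

Lemma tower_set0 : tower next set0.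
Proof. by rewrite -(bigcup_set0 id); apply: tower_bigcup. Qed.

Lemma rank_max S S' : tower next S' -> sat (S `|` S') !=set0 -> S' `<=` rank S.
Proof. by move=> TS' SS' c Sc; exists S'. Qed.

(** By compactness a last stage exists: a finite subsystem of the union comes from a
    single member of the tower, as the tower is a chain. *)
Lemma sat_rank S : sat S !=set0 -> sat (S `|` rank S) !=set0.
Proof.
move=> S0; apply: sat_compact => s sS.
suff [S' [TS' S'0 sS']] : exists S', [/\ tower next S', sat (S `|` S') !=set0 &
    lists (S `|` S') s].
  have [f fS] := S'0; exists f; exact: sat_subset fS.
elim: s sS => [_|c s IH].
  by exists set0; split; [exact: tower_set0|rewrite setU0|].
move=> /lists_cons[cS /IH[S' [TS' S'0 sS']]].
case: cS => [Sc|[D [TD D0] Dc]].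
  by exists S'; split=> //; apply/lists_cons; split=> //; left.
have [DS'|S'D] := tower_total TD TS'.
  by exists S'; split=> //; apply/lists_cons; split=> //; right; exact: DS'.
exists D; split=> //; apply/lists_cons; split; first by right.
by move=> d /sS'[Sd|S'd]; [left|right; exact: S'D].
Qed.

Lemma sat_rank_next S : sat S !=set0 ->
  ~ (sat (S `|` (rank S `|` [set next (rank S)])) !=set0).
Proof.
move=> S0 /(rank_max (tower_step (tower_rank S))) sub.
have [f Sf] := sat_rank S0.
have [[g [_ gS] gn] _] := nextP (ex_intro _ f (sat_subset (@subsetUr _ _ _) Sf)).
by have := gS _ (sub _ (or_intror erefl)); rewrite leNgt gn.
Qed.

Definition slice_pick S : dual E := xget 0 (sat (S `|` rank S)).

Lemma slice_pickP S : sat S !=set0 -> sat (S `|` rank S) (slice_pick S).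
Proof. by move=> S0; apply: xgetPex; exact: sat_rank. Qed.

(** Since [sat S] does not survive the removal of the slice at its rank, by
    compactness neither does [sat [set` s]] for some finite part [s] of [S]. As [s]
    and [S] then have the same rank, [slice_pick [set` s]] and any point of
    [sat S] at its rank lie in the slice removed there. *)
Lemma slice_pick_finite S : sat S !=set0 ->
  exists2 s, lists S s & exists2 f, sat S f & `|slice_pick [set` s] - f| < e.
Proof.
move=> S0; set c := next (rank S).
have [s sS s0] : exists2 s, lists S s &
    ~ (sat ([set` s] `|` (rank S `|` [set c])) !=set0).
  apply: contrapT => nos; apply: (sat_rank_next S0); apply: sat_compact => u uS.
  suff [s sS us] : exists2 s, lists S s & lists ([set` s] `|` (rank S `|` [set c])) u.
    have [f fs] : sat ([set` s] `|` (rank S `|` [set c])) !=set0.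
      by apply: contrapT => ns; apply: nos; exists s.
    by exists f; exact: sat_subset fs.
  elim: u uS => [_|d u IH]; first by exists [::].
  move=> /lists_cons[[Sd|rd] /IH[s sS us]]; last first.
    by exists s => //; apply/lists_cons; split=> //; right.
  exists (d :: s); first exact/lists_cons.
  apply/lists_cons; split; first by left; exact: mem_head.
  move=> b /us[sb|]; last by right.
  by left; rewrite /mkset in_cons [b \in s]sb orbT.
exists s => //.
have [f Sf] := sat_rank S0.
have sfin : sat [set` s] !=set0.
  by exists f; apply: sat_subset Sf => d /sS; left.
have rkE : rank [set` s] = rank S.
  apply/seteqP; split; last first.
    apply: rank_max; first exact: tower_rank.
    by exists f; apply: sat_subset Sf => d [/sS|]; [left|right].
  have [//|sub] := tower_linear (tower_rank S) (tower_rank [set` s]).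
  have [g gs] := sat_rank sfin; case: s0; exists g.
  by apply: sat_subset gs; apply: setUS.
have out g : sat ([set` s] `|` rank S) g -> c.2 < g c.1.
  move=> [g1 gs]; rewrite ltNge; apply/negP => gc; apply: s0; exists g; split=> //.
  by move=> d [sd|[rd|->//]]; apply: gs; [left|right].
have ps : sat ([set` s] `|` rank S) (slice_pick [set` s]) by rewrite -rkE; exact: slice_pickP.
have fs : sat ([set` s] `|` rank S) f.
  by apply: sat_subset Sf => d [/sS|]; [left|right].
exists f; first exact: sat_subset Sf.
have [_] := nextP (ex_intro _ f (sat_subset (@subsetUr _ _ _) Sf)); apply.
- exact: sat_subset ps.
- exact: out.
- exact: sat_subset fs.
- exact: out.
Qed.

End Dentability.

(** * Locally constant approximations of the identity *)

Lemma well_order_least (T : choiceType) : exists W : rel T,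
  (forall x y, W x y -> W y x -> x = y) /\
  forall A : set T, A !=set0 -> exists2 x, A x & forall y, A y -> W x y.
Proof.
have [W Wwo] := wochoice.well_ordering_principle T.
have least (A : set T) : A !=set0 -> exists2 x, A x & forall y, A y -> W x y.
  move=> [x Ax]; have [|z [[/asboolP Az zmin] _]] := Wwo (fun x => `[< A x >]).
    by exists x; exact/asboolP.
  by exists z => // y Ay; apply: zmin; exact/asboolP.
exists W; split=> // x y Wxy Wyx.
have Wxx z : W z z by have [|w ->] := least [set z]; [exists z|exact].
have [|z [_ zuniq]] := Wwo (fun z => (z == x) || (z == y)).
  by exists x; rewrite /in_mem/= eqxx.
transitivity z; first apply/esym; apply: zuniq; split.
- by rewrite /in_mem/= eqxx.
- by move=> z'; rewrite /in_mem/= => /orP[]/eqP->.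
- by rewrite /in_mem/= eqxx orbT.
- by move=> z'; rewrite /in_mem/= => /orP[]/eqP->.
Qed.

Section LocallyConstant.
Context {R : realType} {E : normedModType R}.

(** The proof by A. H. Stone and M. E. Rudin that the cover by balls of radius [r]
    has a sigma-discrete refinement. Well-order the centers; let [l c] be the first
    center within [r] of [c], and let [U n x] be the union of the balls of radius
    [1 / (n + 1)] about those [c] with [l c = x] for which the ball of three
    times that radius stays within [r] of [x]. For fixed [n] these sets are disjoint,
    so that the map sending [U n x] to [x] is well defined. *)
Lemma locally_constant_scale (r : R) : 0 < r ->
  exists h : nat -> E -> option E,
    (forall n x c, h n x = Some c -> \forall y \near x, h n y = Some c) /\
    (forall x, exists n c, h n x = Some c /\ `|c - x| < r).
Proof.
move=> r0; have [W [Wanti Wleast]] := well_order_least E.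
have /choice[l lP] : forall c : E, exists x : E,
    `|c - x| < r /\ forall y, `|c - y| < r -> W x y.
  move=> c; have [|x cx xmin] := Wleast [set x | `|c - x| < r].
    by exists c; rewrite /= subrr normr0.
  by exists x.
pose U n x : set E := [set p | exists c,
  [/\ l c = x, `|c - x| + 3 * n.+1%:R^-1 <= r & `|p - c| < n.+1%:R^-1]].
have U1 n x x' p : U n x p -> U n x' p -> x = x'.
  move=> [c [lc cx pc]] [c' [lc' cx' pc']].
  have d0 : 0 < n.+1%:R^-1 :> R by rewrite invr_gt0.
  (* The triangle inequality puts c within r of x' and c' within r of x, so that
     each of x and x' precedes the other. *)
  have cc' : `|c - c'| < 2 * n.+1%:R^-1.
    rewrite -(subrK p c) -addrA; apply: le_lt_trans (ler_normD _ _) _.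
    by rewrite mulr_natl mulr2n ltrD// distrC.
  have {}cc' : `|c - c'| < 3 * n.+1%:R^-1.
    by apply: lt_le_trans cc' _; rewrite ler_wpM2r ?ler_nat// ltW.
  have c'x : `|c' - x| < r.
    rewrite -(subrK c c') -addrA; apply: le_lt_trans (ler_normD _ _) _.
    by apply: lt_le_trans cx; rewrite [ltLHS]addrC distrC ltrD2l distrC.
  have cx'' : `|c - x'| < r.
    rewrite -(subrK c' c) -addrA; apply: le_lt_trans (ler_normD _ _) _.
    by apply: lt_le_trans cx'; rewrite [ltLHS]addrC ltrD2l.
  have [_ xmin] := lP c; have [_ x'min] := lP c'.
  by apply: Wanti; rewrite -?lc -?lc'; [apply: xmin; rewrite lc'|apply: x'min; rewrite lc].
have /choice[h hP] : forall np : nat * E, exists o : option E,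
    forall x, o = Some x <-> U np.1 x np.2.
  move=> [n p] /=; have [[x Ux]|nU] := pselect (exists x, U n x p).
    by exists (Some x) => y; split=> [[<-//]|Uy]; congr Some; exact: U1 Ux Uy.
  by exists None => y; split=> // Uy; case: nU; exists y.
exists (fun n p => h (n, p)); split=> [n p x /hP[c [lc cx pc]]|p].
  have : \forall y \near p, `|y - c| < n.+1%:R^-1.
    near=> y; rewrite -(subrK p y) -addrA; apply: le_lt_trans (ler_normD _ _) _.
    rewrite -ltrBrDr distrC; near: y; apply: cvgr_dist_lt; first exact: cvg_id.
    by rewrite subr_gt0.
  by apply: filterS => y yc; apply/hP; exists c.
have [px _] := lP p.
have [n np] : exists n, 3 * n.+1%:R^-1 <= r - `|p - l p|.
  have d0 : 0 < (r - `|p - l p|) / 3 by rewrite divr_gt0// subr_gt0.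
  have [n _ nP] := near_infty_natSinv_lt (PosNum d0).
  exists n; have := nP n (leqnn n); rewrite /= ltr_pdivlMr// mulrC; exact: ltW.
exists n, (l p); split; last by rewrite distrC.
apply/hP; exists p; split=> //; last by rewrite subrr normr0 invr_gt0.
by rewrite /= -lerBrDl.
Unshelve. all: by end_near. Qed.

(** The maps [h j] are partial, as the open sets on which they are constant cover the
    space only for all [j] together. *)
Lemma locally_constant_approximations : exists h : nat -> E -> option E,
  (forall j x c, h j x = Some c -> \forall y \near x, h j y = Some c) /\
  (forall x e, 0 < e -> exists j c, h j x = Some c /\ `|c - x| < e).
Proof.
have /choice[h hP] : forall k : nat, exists h : nat -> E -> option E,
    (forall n x c, h n x = Some c -> \forall y \near x, h n y = Some c) /\
    (forall x, exists n c, h n x = Some c /\ `|c - x| < k.+1%:R^-1).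
  by move=> k; apply: locally_constant_scale; rewrite invr_gt0.
exists (fun j => if unpickle j is Some (k, n) then h k n else fun=> None); split.
  by move=> j x c; case: unpickle => // -[k n]; have [+ _] := hP k; apply.
move=> x e e0; have [k _ kP] := near_infty_natSinv_lt (PosNum e0).
have [_ /(_ x)[n [c [hc cx]]]] := hP k.
exists (pickle (k, n)), c; rewrite pickleK; split=> //.
exact: lt_trans cx (kP k (leqnn k)).
Qed.

End LocallyConstant.

(** * Rational spans *)

Section ClosureNormed.
Context {R : realType} {E : normedModType R}.
Implicit Types A B : set E.

Lemma closure_normP A x :
  closure A x <-> forall e : R, 0 < e -> exists2 a, A a & `|x - a| < e.
Proof.
split=> [Ax e e0|Ax B /nbhs_ballP[e /= e0 eB]].
  have [a [Aa]] := Ax _ (nbhsx_ballx x e e0).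
  by rewrite -ball_normE /= => xa; exists a.
have [a Aa xa] := Ax e e0; exists a; split=> //; apply: eB.
by rewrite -ball_normE.
Qed.

(** Rational coefficients keep the span of a countable set countable. *)
Definition qspan A : set E :=
  \bigcup_(l in lists (A `*` [set: rat])) [set \sum_(p <- l) ratr p.2 *: p.1].

Lemma sub_qspan A : A `<=` qspan A.
Proof.
move=> x Ax; exists [:: (x, 1)]; first by apply/lists_cons; split.
by rewrite /= big_seq1 /= rmorph1 scale1r.
Qed.

Lemma qspan0 A : qspan A 0.
Proof. by exists [::] => //=; rewrite big_nil. Qed.

Lemma qspanD A x y : qspan A x -> qspan A y -> qspan A (x + y).
Proof.
move=> [l Al ->] [l' Al' ->]; exists (l ++ l'); first exact/lists_cat.
by rewrite /= big_cat.
Qed.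

Lemma qspanZ A q x : qspan A x -> qspan A (ratr q *: x).
Proof.
move=> [l Al ->]; exists [seq (p.1, q * p.2) | p <- l].
  elim: l Al => //= p l IH /lists_cons[[Ap _] Al]; apply/lists_cons; split=> //.
  exact: IH.
by rewrite /= big_map scaler_sumr; apply: eq_bigr => p _; rewrite scalerA rmorphM.
Qed.

Lemma finitary_qspan : finitary (@qspan).
Proof.
have f1 : finitary (fun A : set E => A `*` [set: rat]).
  exact/finitary_setX/countableP.
have f2 := finitary_comp f1 finitary_lists.
apply: (finitary_comp f2 (finitary_bigcup (g := fun l : seq (E * rat) =>
  [set \sum_(p <- l) ratr p.2 *: p.1]) _)).
by move=> l; exact: countable1.
Qed.

(** The closure of a rational subspace is a real subspace, as the rationals are
    dense in the reals. *)
Lemma closure_qspanP A a u v : closure (qspan A) u -> closure (qspan A) v ->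
  closure (qspan A) (a *: u + v).
Proof.
move=> /closure_normP Au /closure_normP Av; apply/closure_normP => e e0.
have e3 : 0 < e / 3 by rewrite divr_gt0.
have [v' Av' vv'] := Av _ e3.
have u1 : 0 < `|u| + 1 by rewrite ltr_pwDr.
have [q /andP[aq qa]] : exists q : rat, a < ratr q < a + e / 3 / (`|u| + 1).
  have /rat_in_itvoo[q] : a < a + e / 3 / (`|u| + 1) by rewrite ltrDl divr_gt0.
  by rewrite in_itv /= => ?; exists q.
have q1 : 0 < `|ratr q : R| + 1 by rewrite ltr_pwDr.
have [u' Au' uu'] := Au (e / 3 / (`|ratr q| + 1)) (divr_gt0 e3 q1).
exists (ratr q *: u' + v'); first by apply: qspanD => //; exact: qspanZ.
have -> : a *: u + v - (ratr q *: u' + v') =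
    (a - ratr q) *: u + ratr q *: (u - u') + (v - v').
  rewrite scalerBl scalerBr opprD !addrA; congr (_ - _).
  by rewrite -!addrA; congr (_ + _); rewrite addrA addNr add0r addrC.
have -> : e = e / 3 + e / 3 + e / 3.
  by rewrite -!mulrDl -addrA -mulr2n -mulrS -[e *+ 3]mulr_natr mulfK.
rewrite (le_lt_trans (ler_normD _ _))// ltrD//.
rewrite (le_lt_trans (ler_normD _ _))// ltrD// normrZ.
  apply: (@le_lt_trans _ _ (`|a - ratr q| * (`|u| + 1))).
    by apply: ler_wpM2l => //; rewrite lerDl.
  by rewrite -ltr_pdivlMr// distrC gtr0_norm ?subr_gt0// ltrBlDl.
apply: (@le_lt_trans _ _ ((`|ratr q| + 1) * `|u - u'|)).
  by apply: ler_wpM2r => //; rewrite lerDl.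
by rewrite mulrC -ltr_pdivlMr.
Qed.

Definition cspan A : csub E :=
  CSub (@closed_closure _ (qspan A)) (subset_closure (@qspan0 A)) (@closure_qspanP A).

End ClosureNormed.

Section DualLimit.
Context {R : realType} {E : normedModType R}.

Lemma dual_norm_le (f : dual E) (M : R) : 0 <= M ->
  (forall x, f x <= M * `|x|) -> `|f| <= M.
Proof.
move=> M0 fM; apply: op_norm_le => x x1.
have xM : M * `|x| <= M by rewrite ler_piMr.
rewrite ler_norml (le_trans (fM x) xM) andbT lerNl -linearN.
by rewrite (le_trans (fM (- x)))// normrN.
Qed.

(** Norm completeness of the dual, from weak-star compactness: the limit is a point
    common to all the balls of radius [e k] about [u k]. *)
Lemma dual_limit (u : nat -> dual E) (e : nat -> R) :
  (forall k, `|u k| <= 1) -> (forall k m, (k <= m)%N -> `|u m - u k| <= e k) ->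
  exists f : dual E, forall k, `|f - u k| <= e k.
Proof.
move=> u1 ue; have e0 k : 0 <= e k by rewrite (le_trans _ (ue k k (leqnn k))).
have [|f [_ fS]] := @sat_compact R E
  [set c | exists k, c.2 = u k c.1 + e k * `|c.1|].
  move=> s sS.
  have [m mP] : exists m, forall c, c \in s -> exists2 k, (k <= m)%N &
      c.2 = u k c.1 + e k * `|c.1|.
    elim: s sS => [|c s IH]; first by exists 0%N.
    move=> /lists_cons[[k ck] /IH[m mP]]; exists (maxn k m) => d.
    rewrite in_cons => /orP[/eqP->|/mP[k' k'm dk']].
      by exists k; rewrite ?leq_maxl.
    by exists k' => //; rewrite leq_max k'm orbT.
  exists (u m); split=> // c /mP[k km ->].
  rewrite -lerBlDl; apply: le_trans (ler_norm _) _.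
  by apply: le_trans (ler_op_norm (u m - u k) c.1) _; rewrite ler_wpM2r ?ue.
exists f => k; apply: dual_norm_le => // x.
rewrite -[(f - u k) x]/(f x - u k x) lerBlDl.
by apply: (fS (x, _)); exists k.
Qed.

End DualLimit.

Lemma restr_norm_le {R : realType} {E : normedModType R} (V : csub E) (f : dual E) :
  `|restr V f| <= `|f|.
Proof.
apply: dual_norm_le => // x; apply: le_trans (ler_norm _) _.
exact: (ler_op_norm f (csub_val x)).
Qed.

(** * The generator *)

(** An Asplund generator. The second clause, with monotonicity, says that [G] takes
    the same value on a set and on a dense subset of it. *)
Definition generator {R : realType} {X : normedModType R}
    (G : set X -> set (dual X)) :=
  [/\ finitary G,
      (forall C D, D `<=` closure C -> G D `<=` G C) &
      (forall (V : csub X) (g : dual (csub_space V)) (e : R), `|g| <= 1 -> 0 < e ->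
         exists2 f, G V f & `|restr V f - g| < e)].

Section Generator.
Context {R : realType} {X : normedModType R}.
Hypothesis X_dentable : weak_star_dentable X.

Lemma dentable_picks : exists pk : nat -> seq (X * R) -> dual X,
  forall n S, sat S !=set0 ->
    exists2 s, lists S s & exists2 f, sat S f & `|pk n s - f| < n.+1%:R^-1.
Proof.
have /choice[pk pkP] : forall n, exists pk : seq (X * R) -> dual X,
    forall S, sat S !=set0 ->
    exists2 s, lists S s & exists2 f, sat S f & `|pk s - f| < n.+1%:R^-1.
  move=> n; have e0 : 0 < n.+1%:R^-1 :> R by rewrite invr_gt0.
  have [next nextP] := small_slice X_dentable e0.
  by exists (fun s => slice_pick next [set` s]) => S S0; have := slice_pick_finite nextP S0.
by exists pk.
Qed.

(** The points picked from the finite lists of half-spaces [f c <= b] with [b]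
    rational and [c] a value on [V] of one of the maps [h j]. A value taken by [h j]
    at a point is also taken at all nearby points, hence on every dense subset.
    Although the directions [c] need not lie in [V], these half-spaces do cut out
    the set [K] of extensions of [g], because the [c] come arbitrarily close to each
    point of [V]. *)
Lemma exists_generator : exists G : set X -> set (dual X), generator G.
Proof.
have [h [h_loc h_approx]] := @locally_constant_approximations R X.
have [pk pkP] := dentable_picks.
pose N (A : set X) : set X := \bigcup_(x in A) [set c | exists j, h j x = Some c].
pose cond (t : X * rat) : X * R := (t.1, ratr t.2).
pose Z (A : set X) : set (dual X) :=
  \bigcup_(t in lists (N A `*` [set: rat])) [set pk n (map cond t) | n in [set: nat]].
have Nfin : finitary N.
  apply: finitary_bigcup => x.
  apply: sub_countable (countableP [set: nat]).
  apply: card_le_trans (card_image_le (fun j => odflt x (h j x)) _).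
  by apply: subset_card_le => c [j hj]; exists j => //; rewrite hj.
exists Z; split.
- have f1 := finitary_comp Nfin (finitary_setX (countableP [set: rat])).
  have f2 := finitary_comp f1 finitary_lists.
  apply: (finitary_comp f2 (finitary_bigcup (g := fun t : seq (X * rat) =>
    [set pk n (map cond t) | n in [set: nat]]) _)).
  move=> t; apply: sub_countable (countableP [set: nat]); exact: card_image_le.
- move=> C D DC; suff NDC : N D `<=` N C.
    by move=> f [t tD tf]; exists t => // p /tD[/NDC Np _].
  move=> c [x /DC Cx [j hj]].
  by have [y [Cy hy]] := Cx _ (h_loc _ _ _ hj); exists y => //; exists j.
move=> V g e g1 e0.
have [f0 f0g f01] := dual_ext g.
pose K : set (dual X) := [set f | `|f| <= 1 /\ restr V f = g].
have K0 : K f0 by split=> //; exact: le_trans f01 g1.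
(* All the half-spaces of the allowed form that contain K. *)
pose S := [set c : X * R | (exists2 t : X * rat, N V t.1 & c = cond t) /\
  forall f, K f -> f c.1 <= c.2].
have SK f : sat S f -> K f.
  move=> [f1 fS]; split=> //.
  have le (v : csub_space V) : f (csub_val v) <= g v.
    apply/ler_addgt0Pr => d d0.
    have d3 : 0 < d / 3 by rewrite divr_gt0.
    have [j [c [hc cv]]] := h_approx (csub_val v) _ d3.
    have fc (f' : dual X) : `|f'| <= 1 -> `|f' c - f' (csub_val v)| < d / 3.
      move=> f'1; rewrite -linearB; apply: le_lt_trans (ler_op_norm f' _) _.
      by apply: le_lt_trans cv; rewrite ler_piMl.
    have /rat_in_itvoo[b] : g v + d / 3 < g v + d / 3 + d / 3 by rewrite ltrDl.
    rewrite in_itv /= => /andP[gb bg].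
    have Sc : S (c, ratr b).
      split; first by exists (c, b) => //; exists (csub_val v);
        [have /asboolP := csub_valP v|exists j].
      move=> f' [f'1 f'g] /=; apply/ltW; apply: lt_trans gb.
      rewrite addrC -ltrBlDr -f'g.
      exact: le_lt_trans (ler_norm _) (fc f' f'1).
    have := fS _ Sc; rewrite /= => fb.
    have := fc f f1; rewrite distrC => /(le_lt_trans (ler_norm _)).
    rewrite ltrBlDr => fv; apply/ltW; apply: lt_le_trans fv _.
    apply: le_trans (_ : d / 3 + (g v + d / 3 + d / 3) <= _).
      by rewrite lerD2l; apply: le_trans fb (ltW bg).
    rewrite addrC -!addrA lerD2l -!mulrDl -mulr2n -mulrS -[d *+ 3]mulr_natr mulfK//.
  apply/val_inj/funext => v; apply/eqP; rewrite eq_le; apply/andP; split.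
    exact: le.
  have := le (- v); rewrite !linearN lerN2; exact.
have S0 : sat S f0 by split; [exact: K0.1|move=> c [_]; exact].
have [n _ nP] := near_infty_natSinv_lt (PosNum e0).
have [s sS [f Sf sf]] := pkP n S (ex_intro _ _ S0).
have [t tV ts] : exists2 t, lists (N V `*` [set: rat]) t & s = map cond t.
  elim: s sS {sf} => [_|c s IH]; first by exists [::].
  move=> /lists_cons[[[t Nt ->] _] /IH[u uV ->]]; exists (t :: u) => //.
  by apply/lists_cons.
exists (pk n s); first by exists t => //; exists n => //; rewrite ts.
have [f1 <-] := SK f Sf; rewrite -linearB.
apply: le_lt_trans (restr_norm_le V _) (lt_trans sf _).
exact: (nP n (leqnn n)).
Qed.

End Generator.

Lemma restrB {R : realType} {E : normedModType R} (V : csub E) (f g : dual E) :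
  restr V (f - g) = restr V f - restr V g.
Proof. exact: (linearB (restr V)). Qed.

Lemma restrZ {R : realType} {E : normedModType R} (V : csub E) a (f : dual E) :
  restr V (a *: f) = a *: restr V f.
Proof. exact/val_inj/funext. Qed.

Lemma restrP {R : realType} {E : normedModType R} (V : csub E) a (f g : dual E) :
  restr V (a *: f + g) = a *: restr V f + restr V g.
Proof. exact/val_inj/funext. Qed.

(** * Rich subspaces and their partners *)

Section Rich.
Context {R : realType} {X : normedModType R}.
Variable G : set X -> set (dual X).
Hypothesis genG : generator G.

Let Gfin : finitary G. Proof. by case: genG. Qed.

Lemma finitary_qspanG : finitary (qspan \o G).
Proof. exact: finitary_comp Gfin finitary_qspan. Qed.

Let Qmono A B : A `<=` B -> qspan (G A) `<=` qspan (G B).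
Proof. by have [+ _ _] := finitary_qspanG; exact. Qed.

Lemma qspanG_dense C D : D `<=` closure C -> qspan (G D) `<=` qspan (G C).
Proof.
move=> DC; have [_ /(_ _ _ DC) GDC _] := genG.
by have [+ _ _] := @finitary_qspan R (dual X); apply.
Qed.

Definition partner (V : csub X) : csub (dual X) := cspan (G V).

(** Norming is required on the rational span of [G V], not on its closure: in this
    form it visibly passes to directed unions. *)
Definition rich (V : csub X) := (exists2 v, (V : set X) v & v != 0) /\
  forall f, qspan (G V) f -> `|f| <= `|restr V f|.

Lemma partner_mono (V U : csub X) : (V : set X) `<=` U ->
  (partner V : set (dual X)) `<=` partner U.
Proof. by move=> VU; apply: closure_subset; exact: Qmono. Qed.

Section OneSubspace.
Variable V : csub X.
Hypothesis V_rich : rich V.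

Lemma restr_partner_norm f : csub_set (partner V) f -> `|restr V f| = `|f|.
Proof.
move=> /closure_normP Vf; apply/eqP; rewrite eq_le restr_norm_le /=.
apply/ler_addgt0Pr => e e0; have e2 : 0 < e / 2 by rewrite divr_gt0.
have [h Vh fh] := Vf _ e2.
have hh := V_rich.2 h Vh.
rewrite -[f in leLHS](subrK h); apply: le_trans (ler_normD _ _) _.
rewrite [e]splitr addrA [leLHS]addrC; apply: lerD; last exact: ltW.
apply: le_trans hh _; have -> : h = f - (f - h) by rewrite opprB addrC subrK.
rewrite linearB; apply: le_trans (ler_normB _ _) _; rewrite lerD2l.
by apply: le_trans (restr_norm_le _ _) (ltW fh).
Qed.

Lemma partner_sub f g : csub_set (partner V) f -> csub_set (partner V) g ->
  csub_set (partner V) (f - g).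
Proof.
by move=> Vf Vg; rewrite addrC -scaleN1r; exact: (csubP (c := partner V)).
Qed.

Lemma restr_partner_inj f g : csub_set (partner V) f -> csub_set (partner V) g ->
  restr V f = restr V g -> f = g.
Proof.
move=> Vf Vg fg; apply/eqP; rewrite -subr_eq0 -normr_eq0.
by rewrite -(restr_partner_norm (partner_sub Vf Vg)) restrB fg subrr normr0.
Qed.

(** For a functional of norm at most [1 / 2] the approximations in [G V] have norm at
    most one and, [V] being rich, are as close to one another as their
    restrictions: they converge in the dual of [X]. *)
Lemma restr_partner_surj (g : dual (csub_space V)) :
  exists2 f, csub_set (partner V) f & restr V f = g.
Proof.
suff small (g' : dual (csub_space V)) : `|g'| <= 2^-1 ->
    exists2 f, csub_set (partner V) f & restr V f = g'.
  have m0 : 0 < 2 * (`|g| + 1) by rewrite mulr_gt0// ltr_pwDr.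
  have [|f Vf fg] := small ((2 * (`|g| + 1))^-1 *: g).
    rewrite normrZ gtr0_norm ?invr_gt0// invfM -mulrA ler_piMr//.
    by rewrite mulrC ler_pdivrMr ?mul1r ?lerDl// ltr_pwDr.
  exists ((2 * (`|g| + 1)) *: f).
    by rewrite -[X in csub_set _ X]addr0; apply: csubP => //; exact: csub0.
  by rewrite restrZ fg scalerA divff ?scale1r// gt_eqF.
move=> g2; have [_ _ Gapprox] := genG.
(* The shift to n + 2 makes every error at most 1 / 2. *)
pose e n : R := n.+2%:R^-1.
have e0 n : 0 < e n by rewrite invr_gt0.
have emono k m : (k <= m)%N -> e m <= e k.
  by move=> km; rewrite lef_pV2 ?posrE ?ltr0n// ler_nat.
have g1 : `|g'| <= 1 by rewrite (le_trans g2)// invf_le1 ?ler1n.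
have /choice[u uP] : forall n, exists f, G V f /\ `|restr V f - g'| < e n.
  by move=> n; have [f Gf fg] := Gapprox V g' (e n) g1 (e0 n); exists f.
have uV n : qspan (G V) (u n) by apply: sub_qspan; exact: (uP n).1.
have uV' n : csub_set (partner V) (u n) by apply: subset_closure.
have u1 n : `|u n| <= 1.
  rewrite -(restr_partner_norm (uV' n)) -[restr V _](subrK g').
  apply: le_trans (ler_normD _ _) _; rewrite [leRHS]splitr mul1r lerD//.
  exact: le_trans (ltW (uP n).2) (emono 0%N n isT).
have [|f fu] := @dual_limit R X u (fun n => 2 * e n) u1.
  move=> k m km; rewrite -(restr_partner_norm (partner_sub (uV' m) (uV' k))).
  rewrite restrB -[restr V (u m)](subrK g') -addrA mulr_natl mulr2n.
  apply: le_trans (ler_normD _ _) _; apply: lerD.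
    exact: le_trans (ltW (uP m).2) (emono _ _ km).
  by rewrite distrC; exact: ltW (uP k).2.
have small (d : R) : 0 < d -> exists n, e n < d.
  move=> d0; have [n _ nP] := near_infty_natSinv_lt (PosNum d0).
  exists n; apply: le_lt_trans (nP n (leqnn n)).
  by rewrite lef_pV2 ?posrE ?ltr0n// ler_nat.
exists f.
  apply/closure_normP => d d0; have [n nd] := small (d / 2) (divr_gt0 d0 (ltr0Sn _ 1)).
  exists (u n) => //; apply: le_lt_trans (fu n) _.
  by rewrite mulrC -ltr_pdivlMr.
apply/eqP; rewrite -subr_eq0 -normr_le0; apply/ler_addgt0Pr => d d0; rewrite add0r.
have [n nd] := small (d / 3) (divr_gt0 d0 (ltr0Sn _ 2)).
rewrite -(subrK (restr V (u n)) (restr V f)) -addrA.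
apply: le_trans (ler_normD _ _) _; rewrite -restrB.
apply: le_trans (lerD (restr_norm_le _ _) (ltW (uP n).2)) _.
apply: le_trans (lerD (fu n) (lexx _)) _.
by rewrite -[X in _ + X]mul1r -mulrDl natr1 mulrC -ler_pdivlMr// ltW.
Qed.

Lemma exists_projection : exists P : bop (dual X) (dual X), forall f,
  csub_set (partner V) (P f) /\ restr V (P f) = restr V f.
Proof.
have /choice[P PP] : forall f, exists h, csub_set (partner V) h /\ restr V h = restr V f.
  by move=> f; have [h Vh hf] := restr_partner_surj (restr V f); exists h.
have Pb : P \in bounded_linear.
  apply/bounded_linearP; split.
    move=> a f h; apply: restr_partner_inj; first exact: (PP _).1.
      by apply: csubP; exact: (PP _).1.
    by rewrite restrP !(PP _).2 restrP.
  by exists 1 => f; rewrite mul1r -(restr_partner_norm (PP f).1) (PP f).2 restr_norm_le.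
by exists (Bop Pb).
Qed.

Lemma exists_partner_n0 : exists2 f, csub_set (partner V) f & f != 0.
Proof.
have [[v Vv v0] _] := V_rich; have [h hv _] := dual_norming v.
have [f Vf fh] := restr_partner_surj (restr V h); exists f => //.
apply: contra_neq v0 => f0; apply/eqP; rewrite -normr_eq0 -hv.
have /asboolP Vv' := Vv.
have := congr1 (fun g : dual (csub_space V) => g (CSubSpace Vv')) fh.
by rewrite f0 linear0 /= => <-.
Qed.

Variable P : bop (dual X) (dual X).
Hypothesis PP : forall f, csub_set (partner V) (P f) /\ restr V (P f) = restr V f.

Lemma proj_id f : csub_set (partner V) f -> P f = f.
Proof. by move=> Vf; apply: restr_partner_inj => //; [exact: (PP f).1|exact: (PP f).2]. Qed.

Lemma proj_idem : P \o P = P.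
Proof. by apply/funext => f /=; apply: proj_id; exact: (PP f).1. Qed.

Lemma range_proj : range P = partner V.
Proof.
apply/seteqP; split=> [_ [f _ <-]|f Vf]; first exact: (PP f).1.
by exists f => //; exact: proj_id.
Qed.

Lemma norm_proj : `|P| = 1.
Proof.
apply/eqP; rewrite eq_le; apply/andP; split.
  apply: op_norm_le => f f1; rewrite -(restr_partner_norm (PP f).1) (PP f).2.
  exact: le_trans (restr_norm_le _ _) f1.
have [f Vf f0] := exists_partner_n0.
have := ler_op_norm P f; rewrite (proj_id Vf) -[leLHS]mul1r ler_pM2r//.
by rewrite normr_gt0.
Qed.

(** Both sides say that [f] and [0] have the same restriction to [V]. *)
Lemma proj_kernel (f : dual X) : (forall v, (V : set X) v -> f v = 0) <-> P f = 0.
Proof.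
split=> [fV|Pf0 v Vv].
  apply: restr_partner_inj; [exact: (PP f).1|exact: csub0|].
  rewrite (PP f).2 linear0; apply/val_inj/funext => v.
  by apply: fV; apply/asboolP; exact: csub_valP.
have /asboolP Vv' := Vv; have := (PP f).2; rewrite Pf0 linear0.
by move/(congr1 (fun g : dual (csub_space V) => g (CSubSpace Vv'))) => /= <-.
Qed.

End OneSubspace.

End Rich.

(** * Density characters *)

Section DensityCharacter.
Context {R : realType} {E : normedModType R}.

(** A dense subset of [A] is obtained by choosing a point of [A] near each point of
    [D], one for each scale. *)
Lemma dens_le_closure {T : Type} (A D : set E) (B : set T) :
  infinite_set B -> D #<= B -> A `<=` closure D -> dens A #<= B.
Proof.
move=> Binf DB AD; have [->|/set0P[a0 Aa0]] := eqVneq A set0.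
  apply: card_le_trans (card_ge0 E B).
  by apply: (densP (@set0 E)).2; split=> //; exact: subset_closure.
have /choice[c cP] : forall p : E * nat, exists a, A a /\
    ((exists2 x, A x & `|x - p.1| < p.2.+1%:R^-1) -> `|a - p.1| < p.2.+1%:R^-1).
  move=> p; have [[x Ax xp]|] := pselect (exists2 x, A x & `|x - p.1| < p.2.+1%:R^-1).
    by exists x.
  by exists a0.
have cB : c @` (D `*` [set: nat]) #<= B.
  apply: card_le_trans (card_image_le _ _) _; apply: card_le_setX => //.
  exact: countable_le_infinite (countableP _) Binf.
apply: card_le_trans cB; apply: (densP A).2.
split=> [_ [p _ <-]|x Ax]; first exact: (cP p).1.
apply/closure_normP => e e0; have e2 : 0 < e / 2 by rewrite divr_gt0.
have [n _ /(_ n (leqnn n)) ne] := near_infty_natSinv_lt (PosNum e2).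
have n0 : 0 < n.+1%:R^-1 :> R by rewrite invr_gt0.
have [d Dd xd] := (closure_normP _ _).1 (AD x Ax) _ n0.
exists (c (d, n)); first by exists (d, n).
have cd : `|c (d, n) - d| < n.+1%:R^-1 by apply: (cP (d, n)).2; exists x.
rewrite -(subrK d x) -addrA; apply: le_lt_trans (ler_normD _ _) _.
by rewrite [e]splitr; apply: ltrD; [|rewrite distrC]; exact: lt_trans ne.
Qed.

Lemma infinite_csub (V : csub E) v : (V : set E) v -> v != 0 ->
  infinite_set (V : set E).
Proof.
move=> Vv v0; apply/infiniteP.
apply: (@card_le_inj _ _ _ _ (fun n : nat => (n%:R : R) *: v)) => [n _|m n _ _].
  by rewrite -[_ *: v]addr0; apply: csubP => //; exact: csub0.
move=> /eqP; rewrite -subr_eq0 -scalerBl scaler_eq0 (negPf v0) orbF subr_eq0.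
by rewrite eqr_nat => /eqP.
Qed.

Lemma dens_infinite (V : csub E) v : (V : set E) v -> v != 0 ->
  infinite_set (dens V).
Proof.
move=> Vv v0 fD; apply: (infinite_csub Vv v0).
have [[DV VD] _] := densP (V : set E).
have Dcl : closed (dens V).
  apply: accessible_finite_set_closed.1 fD.
  exact/hausdorff_accessible/norm_hausdorff.
by apply: sub_finite_set fD; rewrite ((closure_id _).1 Dcl).
Qed.

Lemma separated_le_dens (S A : set E) (r : R) : 0 < r -> S `<=` A ->
  (forall x y, S x -> S y -> x <> y -> r <= `|x - y|) -> S #<= dens A.
Proof.
move=> r0 SA Ssep; have [[DA AD] _] := densP A.
have r2 : 0 < r / 2 by rewrite divr_gt0.
have /choice[c cP] : forall x, exists d, S x -> dens A d /\ `|x - d| < r / 2.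
  move=> x; have [/SA/AD/closure_normP Ax|] := pselect (S x); last by exists 0.
  by have [d Ad xd] := Ax _ r2; exists d.
apply: (@card_le_inj _ _ _ _ c) => [x /cP[]//|x y Sx Sy cxy].
apply: contrapT => xy; have := Ssep x y Sx Sy xy.
rewrite leNgt => /negP; apply; rewrite -(subrK (c x) x) -addrA.
apply: le_lt_trans (ler_normD _ _) _; rewrite [r]splitr; apply: ltrD.
  by have [] := cP _ Sx.
by rewrite distrC cxy; have [] := cP _ Sy.
Qed.

(** The union over all scales of maximal separated sets is dense, so that at some
    scale the maximal separated set has at least the cardinality of [A]. *)
Lemma separated_of_card {K : Type} (A : set K) :
  infinite_set A -> card_lt A (dens [set: E]) ->
  exists S : set E, S #= A /\
    exists2 r : R, 0 < r & forall x y, S x -> S y -> x <> y -> r <= `|x - y|.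
Proof.
move=> Ainf /andP[Ale /negP Anle].
pose sep n (S : set E) := forall x y, S x -> S y -> x <> y ->
  n.+1%:R^-1 <= `|x - y| :> R.
have /choice[D DP] : forall n, exists D, sep n D /\
    forall B, D `<` B -> ~ sep n B.
  move=> n; apply: Zorn_bigcup => F Fsep Ftot x y [S FS Sx] [S' FS' S'y].
  by have [SS'|S'S] := Ftot _ _ FS FS'; [apply: (Fsep _ FS') => //; exact: SS'|
    apply: (Fsep _ FS) => //; exact: S'S].
have Ddense : [set: E] `<=` closure (\bigcup_n D n).
  move=> x _; apply/closure_normP => e e0.
  have [n _ /(_ n (leqnn n)) ne] := near_infty_natSinv_lt (PosNum e0).
  apply: contrapT => nex.
  have far y : D n y -> n.+1%:R^-1 <= `|x - y|.
    move=> Dy; rewrite leNgt; apply/negP => xy; apply: nex.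
    by exists y; [exists n|exact: lt_trans ne].
  have nDx : ~ D n x.
    by move=> /far; rewrite subrr normr0 leNgt invr_gt0 ltr0n.
  have [Dsep Dmax] := DP n; apply: (Dmax (D n `|` [set x])).
    by split=> [y Dy|/(_ x (or_intror erefl))//]; left.
  move=> y z [Dy|->] [Dz|->] yz //; [exact: Dsep|by rewrite distrC; exact: far|exact: far].
have [f fD finj] := card_le_ex_inj Ale
  (infinite_setN0 (infinite_card_le Ainf Ale)).
have AS : f @` A #= A.
  by apply: inj_card_eq => x y /set_mem Ax /set_mem Ay; exact: finj.
have [n An] : exists n, f @` A #<= D n.
  apply: contrapT => nA; apply: Anle.
  apply: (dens_le_closure (D := \bigcup_n D n)) => //.
  apply: card_le_bigcup => //; first exact: countable_le_infinite (countableP _) Ainf.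
  move=> n _; have [DA|AD] := card_le_total (D n) (f @` A).
    by apply: card_le_trans DA _; exact: card_image_le.
  by case: nA; exists n.
have Dn0 : D n !=set0.
  apply: infinite_setN0; apply: infinite_card_le An.
  by move: AS; rewrite card_eq_le => /andP[_ /(infinite_card_le Ainf)].
have [g gD ginj] := card_le_ex_inj An Dn0.
exists (g @` (f @` A)); split.
  apply: card_eq_trans AS.
  by apply: inj_card_eq => x y /set_mem Ax /set_mem Ay; exact: ginj.
exists n.+1%:R^-1; first by rewrite invr_gt0.
by move=> _ _ [x Ax <-] [y Ay <-]; apply: (DP n).1; exact: gD.
Qed.

End DensityCharacter.

(** * Abundance and completeness of the family *)

Section RichFamily.
Context {R : realType} {X : normedModType R}.
Variable G : set X -> set (dual X).
Hypothesis genG : generator G.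

Lemma restr_mono (V W : csub X) (f : dual X) : (V : set X) `<=` W ->
  `|restr V f| <= `|restr W f|.
Proof.
move=> VW; apply: dual_norm_le => // v.
have Wv : csub_val v \in csub_pred W.
  by apply/asboolP/VW/asboolP; exact: csub_valP.
apply: le_trans (ler_norm _) _; exact: (ler_op_norm (restr W f) (CSubSpace Wv)).
Qed.

Lemma norming_points : exists w : dual X -> nat -> X,
  forall f n, `|w f n| <= 1 /\ `|f| < `|f (w f n)| + n.+1%:R^-1.
Proof.
have /choice[w wP] : forall p : dual X * nat, exists x : X,
    `|x| <= 1 /\ `|p.1| < `|p.1 x| + p.2.+1%:R^-1.
  move=> [f n] /=; have n0 : 0 < n.+1%:R^-1 :> R by rewrite invr_gt0.
  have [_ [x x1 <-] fx] := sup_adherent n0 (bop_has_sup f).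
  by exists x; split=> //; rewrite -ltrBlDr.
by exists (fun f n => w (f, n)) => f n; exact: (wP (f, n)).
Qed.

Lemma norm_le_points (V : csub X) (w : dual X -> nat -> X) (f : dual X) :
  (forall n, `|w f n| <= 1 /\ `|f| < `|f (w f n)| + n.+1%:R^-1) ->
  (forall n, (V : set X) (w f n)) -> `|f| <= `|restr V f|.
Proof.
move=> wP Vw; apply/ler_addgt0Pr => e e0.
have [n _ /(_ n (leqnn n)) ne] := near_infty_natSinv_lt (PosNum e0).
have [w1 fw] := wP n; apply: le_trans (ltW fw) _; apply: lerD; last exact: ltW.
have /asboolP Vw' := Vw n.
exact: (@ler_op_norm1 R _ _ (restr V f) (CSubSpace Vw') w1).
Qed.

(** Close [A] under rational combinations and under norming points for the
    functionals it generates; both operations are finitary. The closure of the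
    result generates no further functionals, hence is rich. *)
Lemma exists_rich (A : set X) : infinite_set A ->
  exists V : csub X, rich G V /\ A `<=` V /\ (dens V #<= A).
Proof.
move=> Ainf; have [w wP] := norming_points.
have Qfin := finitary_qspanG genG.
have wfin : finitary (fun B : set (dual X) => \bigcup_(f in B) [set w f n | n in [set: nat]]).
  apply: finitary_bigcup => f.
  exact: sub_countable (card_image_le _ _) (countableP [set: nat]).
have [M [AM MA Mclosed]] := finitary_closing
  (finitary_setU (@finitary_qspan R X) (finitary_comp Qfin wfin)) Ainf.
have QM : qspan M `<=` M by move=> x Mx; apply: Mclosed; left.
have VM : closure (qspan M) = closure M.
  by apply/seteqP; split; apply: closure_subset => //; exact: sub_qspan.
exists (cspan M); split; last first.
  split; first by apply: subset_trans AM _; rewrite /= VM; exact: subset_closure.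
  by apply: (dens_le_closure Ainf MA); rewrite /= VM.
split.
  have [[v Av v0]|nA] := pselect (exists2 v, A v & v != 0).
    by exists v => //=; rewrite VM; apply: subset_closure; exact: AM.
  exfalso; apply: Ainf; apply: (@sub_finite_set _ _ [set 0]); last exact: finite_set1.
  by move=> v Av; apply/eqP; apply: contrapT => /negP v0; apply: nA; exists v.
move=> f /=; rewrite VM => /(qspanG_dense genG (@subset_refl _ _)) Mf.
apply: (@norm_le_points _ w) => n; first exact: wP.
rewrite /= VM; apply: subset_closure; apply: Mclosed; right.
by exists f => //; exists n.
Qed.

Section DensPartner.
Variable V : csub X.
Hypothesis V_rich : rich G V.

Lemma rich_dens_infinite : infinite_set (dens V).
Proof. by have [[v Vv v0] _] := V_rich; exact: dens_infinite Vv v0. Qed.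

(** The partner is also the closed rational span of [G D] for a dense subset [D]
    of [V]. *)
Lemma dens_partner_le : dens (partner G V) #<= dens V.
Proof.
have Dinf := rich_dens_infinite; have [[DV VD] _] := densP (V : set X).
apply: (@dens_le_closure _ _ _ _ (qspan (G (dens V)))) => //.
  exact: card_le_finitary (finitary_qspanG genG) Dinf (card_lexx _).
by apply: closure_subset; exact: qspanG_dense.
Qed.

(** Choose for each [f] in a dense subset of the partner a point of the unit ball
    of [V] where [f] is at least half its norm. If these points did not span a
    dense subspace of [V], a nonzero functional of the partner would vanish on all
    of them, and so could not be approximated from the dense subset. *)
Lemma dens_partner_ge : dens V #<= dens (partner G V).
Proof.
have [[DY YD] _] := densP (partner G V : set (dual X)).
set D := dens _ in DY YD *.
have Dinf : infinite_set D.
  have [f Yf f0] := exists_partner_n0 genG V_rich; exact: dens_infinite Yf f0.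
have /choice[x xP] : forall f : dual X, exists x, csub_set (partner G V) f ->
    [/\ (V : set X) x, `|x| <= 1 & `|f| <= 2 * `|f x|].
  move=> f; have [Yf|] := pselect (csub_set (partner G V) f); last by exists 0.
  have [->|f0] := eqVneq f 0.
    by exists 0 => _; split; [exact: csub0|rewrite normr0|rewrite !normr0 mulr_ge0].
  have f2 : 0 < `|f| / 2 by rewrite divr_gt0// normr_gt0.
  have [_ [v v1 <-] fv] := sup_adherent f2 (bop_has_sup (restr V f)).
  exists (csub_val v) => _; split=> //; first by apply/asboolP; exact: csub_valP.
  rewrite mulrC -ler_pdivrMr//; apply: le_trans (ltW fv).
  rewrite -[sup _]/`|restr V f| (restr_partner_norm V_rich Yf).
  by rewrite lerBrDr -splitr.
pose M := x @` D.
have MV : qspan M `<=` V.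
  move=> _ [l Ml ->]; elim: l Ml => [_|p l IH]; first by rewrite big_nil; exact: csub0.
  move=> /lists_cons[[[f Df fp] _] Ml]; rewrite big_cons; apply: csubP; last exact: IH.
  by rewrite -fp; have [] := xP f (DY _ Df).
apply: (@dens_le_closure _ _ _ _ (qspan M)) => //.
  by apply: card_le_finitary (@finitary_qspan R X) Dinf _; exact: card_image_le.
move=> v Vv; apply: contrapT => Mv.
have [g gM gv] := dual_separation (V := cspan M) Mv.
have [f Yf fg] := restr_partner_surj genG V_rich (restr V g).
have fgV u : (V : set X) u -> f u = g u.
  move=> Vu; have /asboolP Vu' := Vu.
  exact: (congr1 (fun h : dual (csub_space V) => h (CSubSpace Vu')) fg).
have f0 : 0 < `|f|.
  rewrite normr_gt0; apply: contra_neq gv => f0.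
  by rewrite -fgV// f0.
have f3 : 0 < `|f| / 3 by rewrite divr_gt0.
have [h Dh fh] := (closure_normP _ _).1 (YD _ Yf) _ f3.
have [Vx x1 hx] := xP h (DY _ Dh).
have fx0 : f (x h) = 0.
  rewrite fgV// gM//; apply: subset_closure; apply: sub_qspan.
  by exists h.
have hfh : `|h| <= 2 * `|f - h|.
  apply: le_trans hx _; apply: ler_wpM2l => //.
  have -> : h (x h) = - (f - h) (x h).
    by rewrite -[(f - h) _]/(f (x h) - h (x h)) fx0 add0r opprK.
  by rewrite normrN; exact: ler_op_norm1.
suff : `|f| < `|f| by rewrite ltxx.
rewrite -[f in ltLHS](subrK h); apply: le_lt_trans (ler_normD _ _) _.
apply: le_lt_trans (lerD (lexx _) hfh) _.
by rewrite -[X in X + _]mul1r -mulrDl nat1r mulrC -ltr_pdivlMr.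
Qed.

Lemma dens_partner : dens (partner G V) #= dens V.
Proof. by rewrite card_eq_le dens_partner_le dens_partner_ge. Qed.

End DensPartner.

Lemma rich_dens_mono (V W : csub X) : rich G W -> (V : set X) `<=` W ->
  dens V #<= dens W.
Proof.
move=> W_rich VW; have [[_ WD] _] := densP (W : set X).
apply: dens_le_closure (card_lexx _) (subset_trans VW WD).
exact: rich_dens_infinite W_rich.
Qed.

(** Each functional generated by the closure of the union is generated by one of the
    [V i], which norms it; a larger subspace norms it as well. *)
Lemma rich_directed (I : Type) (V : I -> csub X) : inhabited I ->
  (forall i j, exists k, (V i : set X) `<=` V k /\ (V j : set X) `<=` V k) ->
  (forall i, rich G (V i)) ->
  exists W, [/\ rich G W, (W : set X) = closure (\bigcup_i (V i : set X)) &
    (partner G W : set (dual X)) = closure (\bigcup_i (partner G (V i) : set (dual X)))].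
Proof.
move=> I0 dir Vrich; set U := \bigcup_i (V i : set X).
have [i0] := I0.
have QU : qspan U `<=` U.
  move=> _ [l Ml ->]; elim: l Ml => [_|p l IH].
    by rewrite big_nil; exists i0 => //; exact: csub0.
  move=> /lists_cons[[[i _ Vp] _] /IH[j _ Vl]]; rewrite big_cons.
  by have [k [ik jk]] := dir i j; exists k => //; apply: csubP; [exact: ik|exact: jk].
have WU : closure (qspan U) = closure U.
  by apply/seteqP; split; apply: closure_subset => //; exact: sub_qspan.
have UE : qspan (G U) = \bigcup_i qspan (G (V i)).
  exact: (finitary_directed (finitary_qspanG genG) I0 dir).
have VW i : (V i : set X) `<=` cspan U.
  by rewrite /= WU => v Vv; apply: subset_closure; exists i.
have QWU : qspan (G (cspan U)) = qspan (G U).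
  apply/seteqP; split; first by apply: (qspanG_dense genG); rewrite /= WU.
  apply: (qspanG_dense genG); apply: subset_trans (@subset_closure _ _).
  by rewrite /= WU; exact: subset_closure.
exists (cspan U); split; last 1 first.
- rewrite /partner /= -/(cspan U) QWU UE; apply/seteqP; split.
    apply: closure_subset => f [i _ Vf]; exists i => //; exact: subset_closure.
  rewrite [X in _ `<=` X]((closure_id (closure _)).1 (@closed_closure _ _)).
  apply: closure_subset => f [i _]; apply: closure_subset => {}f Vf.
  by exists i.
- split.
    by have [[v Vv v0] _] := Vrich i0; exists v => //; exact: VW Vv.
  move=> f; rewrite QWU UE => -[i _ Vf].
  by apply: le_trans ((Vrich i).2 f Vf) _; exact: restr_mono.
- by [].
Qed.

End RichFamily.

(** * Weak-star closures *)

Section Bipolar.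
Context {R : realType} {E : normedModType R}.

Lemma dual_linearP (f : dual E) a u v : f (a *: u + v) = a * f u + f v.
Proof. exact: (linearP f). Qed.

Lemma dual_applyP (f g : dual E) a v : (a *: f + g) v = a * f v + g v.
Proof. by []. Qed.

(** The finite-dimensional core of the bipolar theorem, by induction on [s]: if [f]
    does not vanish on [V], pass to the kernel of [f] in [V], after subtracting from
    [F] the multiple of the evaluation at [v0] that makes it vanish at [f]. *)
Lemma finite_interpolation (V : set E) (F : dual E -> R) (s : seq (dual E)) :
  V 0 -> (forall a u v, V u -> V v -> V (a *: u + v)) ->
  (forall a (f g : dual E), F (a *: f + g) = a * F f + F g) ->
  (forall f : dual E, (forall v, V v -> f v = 0) -> F f = 0) ->
  exists2 v, V v & forall f : dual E, f \in s -> f v = F f.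
Proof.
elim: s V F => [|f s IH] V F V0 Vlin Flin FV; first by exists 0.
have [[v0 Vv0 fv0]|nf] := pselect (exists2 v, V v & f v != 0); last first.
  have f0 v : V v -> f v = 0.
    by move=> Vv; apply/eqP; apply: contrapT => /negP fv; apply: nf; exists v.
  have [v Vv vs] := IH V F V0 Vlin Flin FV; exists v => // g.
  by rewrite in_cons => /orP[/eqP->|/vs//]; rewrite f0// FV.
have [c cE] : exists c, c = F f / f v0 by exists (F f / f v0).
have [||||v [Vv fv] vs] := IH [set v | V v /\ f v = 0] (fun h => F h - c * h v0).
- by split=> //; rewrite linear0.
- move=> a u v [Vu fu] [Vv fv]; split; first exact: Vlin.
  by rewrite dual_linearP fu fv mulr0 addr0.
- move=> a h g; rewrite Flin dual_applyP.
  by rewrite mulrDr mulrBr opprD addrACA !mulrA [c * a]mulrC.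
- move=> h hV; pose l := h v0 / f v0.
  have hl v : V v -> (- l *: f + h) v = 0.
    move=> Vv; have Vw : V (- (f v / f v0) *: v0 + v) by apply: Vlin.
    have : h (- (f v / f v0) *: v0 + v) = 0.
      apply: hV; split=> //; rewrite dual_linearP.
      by rewrite mulNr divfK// addNr.
    rewrite dual_linearP => <-; rewrite dual_applyP /l; congr (_ + _).
    by rewrite !mulNr mulrAC [in RHS]mulrAC [f v * _]mulrC.
  have := FV _ hl; rewrite Flin => Fl.
  rewrite cE -(addKr (- l * F f) (F h)) Fl addr0 /l.
  by rewrite !mulNr opprK mulrAC [F f / _ * _]mulrAC [F f * _]mulrC subrr.
exists (c *: v0 + v); first exact: Vlin.
move=> g; rewrite dual_linearP in_cons => /orP[/eqP->|/vs->].
  by rewrite fv addr0 cE divfK.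
by rewrite addrC subrK.
Qed.

(** The bipolar theorem for a subspace: interpolating [F] on larger and larger finite
    sets of functionals gives a net in [V] that converges to [F]. *)
Lemma weak_star_closure (V : csub E) :
  closure (bidual_embed (E := E) @` V : set (weak_star (dual E))) =
  [set F : dual (dual E) | forall f : dual E, (forall v, (V : set E) v -> f v = 0) -> F f = 0].
Proof.
apply/seteqP; split=> F; last first.
  move=> FV B FB.
  have /choice[v vP] : forall s : seq (dual E), exists v : E,
      (V : set E) v /\ forall f : dual E, f \in s -> f v = F f.
    move=> s; have [||||v Vv vs] := @finite_interpolation V F s.
    - exact: csub0.
    - by move=> a u v; exact: csubP.
    - by move=> a f g; rewrite linearP.
    - exact: FV.
    by exists v.
  pose Fil : set_system (seq (dual E)) :=
    [set A | exists s : seq (dual E), forall t : seq (dual E), {subset s <= t} -> A t].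
  have FF : ProperFilter Fil.
    split; first by move=> [s /(_ s (fun _ h => h))].
    split; first by exists [::].
    - move=> A A' [s sA] [t tA']; exists (s ++ t) => u stu; split.
        by apply: sA => f fs; apply: stu; rewrite mem_cat fs.
      by apply: tA' => f ft; apply: stu; rewrite mem_cat ft orbT.
    - by move=> A A' AA' [s sA]; exists s => t /sA/AA'.
  have cvF : {ptws, (fun s => (fun f => f (v s)) : dual E -> R^o) @ Fil -->
      (F : dual E -> R^o)}.
    apply/pointwise_cvgP => f; apply: cvg_near_cst.
    exists [:: f] => t ft /=; apply/eqP; have [_ ->//] := vP t.
    by apply: ft; rewrite mem_head.
  have [_ [[U Uop <-] UF UB]] : exists U : set (weak_star (dual E)),
      [/\ open U, U F & U `<=` B].
    by move: FB; rewrite nbhsE => -[U [Uop UF] UB]; exists U.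
  have [s /(_ s (fun _ h => h)) sU] := cvF U (open_nbhs_nbhs (conj Uop UF)).
  exists (bidual_embed (v s)); split; last by apply: UB.
  by exists (v s) => //; exact: (vP s).1.
move=> FV f fV.
have cl : closed [set H : weak_star (dual E) | (H : dual (dual E)) f = 0].
  apply: (@preimage_closed (weak_star (dual E)) R^o
    (fun H => (H : dual (dual E)) f) [set r | r = 0]); last exact: (@closed_eq R 0).
  move=> H _.
  have c1 := @initial_continuous _ _
    (fun g : dual (dual E) => (g : {ptws dual E -> R^o})) H.
  exact: (cvg_comp _ _ c1 (@proj_continuous (dual E) (fun=> R^o) f _)).
apply: (cl F); apply: closure_subset FV => _ [v Vv <-].
exact: fV.
Qed.

End Bipolar.

(** * Quotients and nested subspaces *)

Section QuotientDual.
Context {R : realType} {E : normedModType R} (V : csub E).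

Lemma quot_map_eq0 (v : E) : quot_map V v = 0 <-> (V : set E) v.
Proof.
by rewrite -(linear0 (quot_map V)) -[X in _ <-> csub_set V X]subr0; exact: quot_piP.
Qed.

Lemma norm_adjoint_quot (g : dual (quot_space V)) : `|adjoint (quot_map V) g| = `|g|.
Proof.
apply/eqP; rewrite eq_le; apply/andP; split; apply: dual_norm_le => // x.
  apply: le_trans (ler_norm _) _; apply: le_trans (ler_op_norm g (quot_map V x)) _.
  apply: ler_wpM2l; first exact: op_norm_ge0. exact: (quot_pi_norm_le V x).
apply/ler_addgt0Pr => e e0.
have g1 : 0 < `|adjoint (quot_map V) g| + 1 by rewrite ltr_pwDr.
have [u <- ux] := quot_norm_approx x (divr_gt0 e0 g1).
apply: le_trans (ler_norm _) _; apply: le_trans (ler_op_norm (adjoint (quot_map V) g) u) _.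
apply: le_trans (ler_wpM2l (op_norm_ge0 _) (ltW ux)) _; rewrite mulrDr lerD2l.
by rewrite mulrCA ler_piMr ?ltW// ltr_pdivrMr// mul1r ltrDl.
Qed.

Lemma annihilator_quot (f : dual E) : (forall v, (V : set E) v -> f v = 0) ->
  exists g : dual (quot_space V), adjoint (quot_map V) g = f.
Proof.
move=> fV.
have /choice[g gP] : forall q : quot_space V, exists r : R,
    forall x, quot_pi V x = q -> f x = r.
  move=> q; have [u uq _] := quot_norm_approx q ltr01.
  exists (f u) => x; rewrite -uq => /quot_piP/fV.
  by rewrite linearB => /eqP; rewrite subr_eq0 => /eqP.
have gf x : g (quot_pi V x) = f x by apply/esym/gP.
have [||//|h hg _] := @dual_of_linear R (quot_space V) g `|f|.
- move=> a p q; have [x <- _] := quot_norm_approx p ltr01.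
  have [y <- _] := quot_norm_approx q ltr01.
  by rewrite -quot_pi_is_linear !gf dual_linearP.
- move=> q; apply/ler_addgt0Pr => e e0.
  have f1 : 0 < `|f| + 1 by rewrite ltr_pwDr.
  have [u <- uq] := quot_norm_approx q (divr_gt0 e0 f1).
  rewrite gf; apply: le_trans (ler_norm _) _; apply: le_trans (ler_op_norm f u) _.
  apply: le_trans (ler_wpM2l (op_norm_ge0 _) (ltW uq)) _; rewrite mulrDr lerD2l.
  by rewrite mulrCA ler_piMr ?ltW// ltr_pdivrMr// mul1r ltrDl.
by exists h; apply/val_inj/funext => x; rewrite -[LHS]/(h (quot_pi V x)) hg gf.
Qed.

End QuotientDual.

Section NestedRich.
Context {R : realType} {X : normedModType R}.
Variable G : set X -> set (dual X).
Hypothesis genG : generator G.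
Variables (V U : csub X) (P Q : bop (dual X) (dual X)).
Hypotheses (V_rich : rich G V) (U_rich : rich G U) (VU : (V : set X) `<=` U).
Hypothesis PP : forall f, csub_set (partner G V) (P f) /\ restr V (P f) = restr V f.
Hypothesis QP : forall f, csub_set (partner G U) (Q f) /\ restr U (Q f) = restr U f.

Lemma restr_eqP (W : csub X) (f g : dual X) :
  restr W f = restr W g <-> forall w, (W : set X) w -> f w = g w.
Proof.
split=> [fg w Ww|fg].
  have /asboolP Ww' := Ww.
  exact: (congr1 (fun h : dual (csub_space W) => h (CSubSpace Ww')) fg).
by apply/val_inj/funext => w; apply: fg; apply/asboolP; exact: csub_valP.
Qed.

Lemma proj_comp_small : P \o Q = P.
Proof.
apply/funext => f /=; apply: (restr_partner_inj V_rich); [exact: (PP _).1..|].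
rewrite !(PP _).2; apply/restr_eqP => v /VU; exact: (restr_eqP U (Q f) f).1 (QP f).2 v.
Qed.

Lemma proj_comp_large : Q \o P = P.
Proof.
apply/funext => f /=; apply: (proj_id U_rich QP).
exact: (partner_mono genG VU (PP f).1).
Qed.

(** On the partner of [U] the difference is the identity minus [P], so that its range
    is the part of this partner annihilated by [P]. *)
Lemma range_projB : range (Q - P) =
  [set f | csub_set (partner G U) f /\ forall v, (V : set X) v -> f v = 0].
Proof.
have QPE f : (Q - P) f = Q f - P f by [].
apply/seteqP; split=> [_ [f _ <-]|f [Uf fV]].
  split; rewrite QPE.
    apply: partner_sub; [exact: (QP f).1|exact: (partner_mono genG VU (PP f).1)].
  apply/(proj_kernel V_rich PP).
  have -> : P (Q f - P f) = (P \o Q) f - (P \o P) f by exact: (linearB P).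
  by rewrite proj_comp_small (proj_idem V_rich PP) subrr.
exists f => //; rewrite QPE (proj_id U_rich QP Uf).
by rewrite ((proj_kernel V_rich PP f).1 fV) subr0.
Qed.

(** A functional on [U / V] is a functional on [U] that vanishes on [V], and it extends
    isometrically to a unique element of the partner of [U]. *)
Lemma projB_isometric :
  linearly_isometric (dual (quot_space (csub_in U V))) (range (Q - P)).
Proof.
rewrite range_projB; pose pi := quot_map (csub_in U V).
have /choice[T TP] : forall g : dual (quot_space (csub_in U V)), exists f,
    csub_set (partner G U) f /\ restr U f = adjoint pi g.
  move=> g; have [f Uf fg] := restr_partner_surj genG U_rich (adjoint pi g).
  by exists f.
have Tlin : linear T.
  move=> a g h; apply: (restr_partner_inj U_rich); first exact: (TP _).1.
    by apply: csubP; exact: (TP _).1.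
  rewrite restrP !(TP _).2; exact/val_inj/funext.
pose T' : {linear dual (quot_space (csub_in U V)) -> dual X} :=
  HB.pack T (GRing.isLinear.Build _ _ _ _ _ Tlin).
exists T'; split.
  move=> g; rewrite -[T' g]/(T g) -(restr_partner_norm U_rich (TP g).1) (TP g).2.
  exact: norm_adjoint_quot.
apply/seteqP; split=> [_ [g _ <-]|f [Uf fV]]; rewrite -?[T' _]/(T _).
  split=> [|v Vv]; first exact: (TP g).1.
  have /asboolP Uv := VU Vv.
  have := congr1 (fun h : dual (csub_space U) => h (CSubSpace Uv)) (TP g).2.
  rewrite -[restr U _ _]/(T g v) => ->.
  rewrite -[LHS]/(g (pi (CSubSpace Uv))).
  by rewrite ((quot_map_eq0 (csub_in U V) (CSubSpace Uv)).2 Vv) linear0.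
have [g gf] := @annihilator_quot _ _ (csub_in U V) (restr U f) (fun v Vv => fV _ Vv).
exists g => //; apply: (restr_partner_inj U_rich); [exact: (TP g).1|by []|].
by rewrite (TP g).2.
Qed.

End NestedRich.

(** * Cofinality *)

Section Cofinality.
Context {R : realType} {X : normedModType R}.
Variable G : set X -> set (dual X).
Hypothesis genG : generator G.

Lemma rich_join (V1 V2 : csub X) : rich G V1 -> rich G V2 ->
  exists V : csub X, [/\ rich G V, (V1 : set X) `|` V2 `<=` V &
    dens V #= card_max (dens V1) (dens V2)].
Proof.
move=> r1 r2; have i1 := rich_dens_infinite r1; have i2 := rich_dens_infinite r2.
have [V [Vr [DV VD]]] := exists_rich genG (sub_infinite_set (@subsetUl _ _ (dens V2)) i1).
have sub (W : csub X) : dens W `<=` dens V1 `|` dens V2 -> (W : set X) `<=` V.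
  move=> WD; have [[_ Wcl] _] := densP (W : set X).
  apply: subset_trans Wcl _; rewrite [X in _ `<=` X]((closure_id (V : set X)).1 (@csub_closed _ _ V)).
  by apply: closure_subset; exact: subset_trans DV.
have V1V : (V1 : set X) `<=` V by apply: sub; exact: subsetUl.
have V2V : (V2 : set X) `<=` V by apply: sub; exact: subsetUr.
exists V; split=> //; first by move=> x [/V1V|/V2V].
rewrite card_eq_le; apply/andP; split.
  apply: card_le_trans VD _; rewrite /card_max; case: ifP => [D12|/negP nD12].
    by apply: card_le_setU => //; exact: card_lexx.
  have [//|D21] := card_le_total (dens V1) (dens V2).
  by apply: card_le_setU => //; exact: card_lexx.
by rewrite /card_max; case: ifP => _; apply: (rich_dens_mono Vr).
Qed.

(** A separated set of the cardinality of [A] is put into [V] in order to keep the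
    density from below. *)
Lemma exists_rich_dens {K : Type} (A : set K) (C : set X) :
  infinite_set A -> card_lt A (dens [set: X]) -> countable C ->
  exists V : csub X, [/\ rich G V, dens V #= A & C `<=` V].
Proof.
move=> Ainf Alt Ccount; have [S [SA [r r0 Ssep]]] := separated_of_card Ainf Alt.
move: (SA); rewrite card_eq_le => /andP[leSA leAS].
have Sinf : infinite_set S := infinite_card_le Ainf leAS.
have [V [Vr [CV VD]]] := exists_rich genG (sub_infinite_set (@subsetUl _ _ C) Sinf).
exists V; split=> //; last by apply: subset_trans CV; exact: subsetUr.
rewrite card_eq_le; apply/andP; split.
  apply: card_le_trans VD _; apply: card_le_setU => //.
  exact: countable_le_infinite Ccount Ainf.
apply: card_le_trans leAS _; apply: separated_le_dens r0 _ Ssep.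
by apply: subset_trans CV; exact: subsetUl.
Qed.

(** The whole space is rich and its partner is the whole dual, so that [f] is the limit
    of a sequence of rational combinations, each of which is generated by finitely
    many points. *)
Lemma functional_countable (f : dual X) :
  (exists x : X, x != 0) -> exists2 C, countable C & closure (qspan (G C)) f.
Proof.
move=> [x0 x00].
pose full : csub X := CSub closedT (I : [set: X] 0) (fun _ _ _ _ _ => I).
have full_rich : rich G full.
  split; first by exists x0.
  move=> h _; apply: dual_norm_le => // x; apply: le_trans (ler_norm _) _.
  have xfull : x \in csub_pred full by exact/asboolP.
  exact: (ler_op_norm (restr full h) (CSubSpace xfull)).
have [h hY hf] := restr_partner_surj genG full_rich (restr full f).
have hfE : h = f.
  by apply/val_inj/funext => x; apply: (restr_eqP full h f).1.
rewrite hfE in hY; have {}hY := (closure_normP _ _).1 hY.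
have [_ Qfin _] := finitary_qspanG genG.
have /choice[s sP] : forall n : nat, exists s : seq X,
    exists2 g, qspan (G [set` s]) g & `|f - g| < n.+1%:R^-1.
  move=> n; have n0 : 0 < n.+1%:R^-1 :> R by rewrite invr_gt0.
  have [g Gg fg] := hY _ n0; have [s _ sg] := Qfin _ _ Gg.
  by exists s, g.
exists (\bigcup_n [set` s n]).
  by apply: bigcup_countable => // n _; apply: finite_set_countable; exact: finite_seq.
apply/closure_normP => e e0.
have [n _ /(_ n (leqnn n)) ne] := near_infty_natSinv_lt (PosNum e0).
have [g sg fg] := sP n; exists g; last exact: lt_trans fg ne.
have [Qmono _ _] := finitary_qspanG genG.
by apply: Qmono sg => x xs; exists n.
Qed.

End Cofinality.

Theorem theorem6 (R : realType) (X : completeNormedModType R)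
    (X_asplund : asplund X) (X_nonseparable : ~ separable [set: X]) :
  exists (VV : set (csub X)) (Y : csub X -> csub (dual X))
      (P : csub X -> bop (dual X) (dual X)),
  (* (i) *)
  (forall (K : Type) (A : set K), infinite_set A -> card_lt A (dens [set: X]) ->
     \bigcup_(V in [set V | VV V /\ dens V #= A]) (V : set X) = [set: X] /\
     \bigcup_(V in [set V | VV V /\ dens V #= A]) (Y V : set (dual X))
       = [set: dual X]) /\
  (* (ii) *)
  (forall V1 V2, VV V1 -> VV V2 ->
     exists V, [/\ VV V, (V1 : set X) `|` V2 `<=` V &
       dens V #= card_max (dens V1) (dens V2)]) /\
  (* (iii) *)
  (forall V, VV V ->
     [/\ restr V @` (Y V : set (dual X)) = [set: dual (csub_space V)],
         forall y z, csub_set (Y V) y -> csub_set (Y V) z ->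
           `|restr V y - restr V z| = `|y - z| &
         forall f, csub_set (Y V) (P V f) /\ restr V (P V f) = restr V f] /\
     [/\ P V \o P V = P V, `|P V| = 1, range (P V) = Y V
       & dens (range (P V)) #= dens V]) /\
  (* (iv) *)
  (forall V, VV V ->
     closure (bidual_embed (E := X) @` V : set (weak_star (dual X)))
       = range (adjoint (P V))) /\
  (* (v) *)
  (forall (d : Order.disp_t) (I : orderType d) (V : I -> csub X),
     limit_order I -> (forall i, VV (V i)) ->
     (forall i j, (i < j)%O -> (V i : set X) `<=` V j) ->
     exists W, [/\ VV W, (W : set X) = closure (\bigcup_i (V i : set X)) &
       (Y W : set (dual X)) = closure (\bigcup_i (Y (V i) : set (dual X)))]) /\
  (* (vi) *)
  (forall V U, VV V -> VV U -> (V : set X) `<=` U ->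
     [/\ (Y V : set (dual X)) `<=` Y U,
         P V \o P U = P V, P U \o P V = P V &
         linearly_isometric (dual (quot_space (csub_in U V)))
           (range (P U - P V))]).
Proof.
have [G genG] := exists_generator X_asplund.
have /choice[P PP] : forall V : csub X, exists P : bop (dual X) (dual X),
    rich G V -> forall f, csub_set (partner G V) (P f) /\ restr V (P f) = restr V f.
  move=> V; have [Vr|] := pselect (rich G V); last by exists 0.
  by have [P PP] := exists_projection genG Vr; exists P.
exists (rich G), (partner G), P; split; [|split; [|split; [|split; [|split]]]].
- move=> K A Ainf Alt.
  have [x0 x00] : exists x : X, x != 0.
    apply: contrapT => nx; apply: X_nonseparable.
    exists [set 0]; first exact: countable1.
    split=> // x _; apply: subset_closure; apply/eqP.
    by apply: contrapT => /negP x0; apply: nx; exists x.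
  split; apply/seteqP; split=> //.
    move=> x _; have [V [Vr VA xV]] := exists_rich_dens genG Ainf Alt (countable1 x).
    by exists V => //; exact: xV.
  move=> f _; have [C Cc fC] := functional_countable genG f (ex_intro _ x0 x00).
  have [V [Vr VA CV]] := exists_rich_dens genG Ainf Alt Cc.
  exists V => //; apply: closure_subset fC.
  by have [Qmono _ _] := finitary_qspanG genG; exact: Qmono.
- exact: rich_join.
- move=> V Vr; have PPV := PP V Vr; split; split=> //.
  + apply/seteqP; split=> // g _.
    by have [f Yf fg] := restr_partner_surj genG Vr g; exists f.
  + move=> y z Yy Yz; rewrite -restrB; apply: (restr_partner_norm Vr).
    exact: partner_sub.
  + exact: (proj_idem Vr PPV).
  + exact: (norm_proj genG Vr PPV).
  + exact: (range_proj Vr PPV).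
  + by rewrite (range_proj Vr PPV); exact: dens_partner.
- move=> V Vr; have PPV := PP V Vr; rewrite weak_star_closure.
  apply/seteqP; split=> [F FV|_ [H _ <-] f /(proj_kernel Vr PPV) Pf0].
    exists F => //; apply/val_inj/funext => f.
    rewrite -[LHS]/(F (P V f)); apply/eqP; rewrite -subr_eq0 -linearB; apply/eqP.
    apply: FV; apply/(proj_kernel Vr PPV).
    have -> : P V (P V f - f) = (P V \o P V) f - P V f by exact: (linearB (P V)).
    by rewrite (proj_idem Vr PPV) subrr.
  by rewrite -[LHS]/(H (P V f)) Pf0 linear0.
- move=> d I V [_ I0 _] Vr Vmono; apply: (rich_directed genG I0) => // i j.
  have [ij|ji|->] := ltgtP i j.
  + by exists j; split=> //; exact: Vmono.
  + by exists i; split=> //; exact: Vmono.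
  + by exists j; split.
- move=> V U Vr Ur VU; split; first exact: partner_mono.
  + exact: (proj_comp_small Vr VU (PP V Vr) (PP U Ur)).
  + exact: (proj_comp_large genG Ur VU (PP V Vr) (PP U Ur)).
  + exact: (projB_isometric genG Vr Ur VU (PP V Vr) (PP U Ur)).
Qed.
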